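(* Let $n\in\mathbb{N}$, $\hbar\in{]0,\infty[}$ and $\mu\in{[0,\infty[}$. Let $\mathcal{B}_\hbar=\bigoplus_{k\in\mathbb{N}_0}\mathscr{P}^{k,k}(\mathbb{C}^{1+n})$ with product $\star_\hbar$ and pointwise complex conjugation as involution, and let $\langle\mathcal{J}-\mu\rangle$ be the $^*$-ideal of $\mathcal{B}_\hbar$ generated by $\mathcal{J}-\mu\mathbb{1}$ with respect to $\star_\hbar$. Then $$\mathcal{R}_{\hbar,\mu}=(\mathcal{B}_\hbar)^{++}_{\mathrm H}+\big(\langle\mathcal{J}-\mu\rangle\big)_{\mathrm H}.$$ Equivalently: every $f\in(\mathcal{B}_\hbar)_{\mathrm H}$ such that $\langle\psi,\pi_\hbar(f)\psi\rangle_\hbar\ge 0$ for all $\psi$ in the Fock space with $\pi_\hbar(\mathcal{J})\psi=\mu\psi$ can be written as $f=\sum_{j=1}^{\ell}\overline{g_j}\star_\hbar g_j+(\mathcal{J}-\mu\mathbb{1})\star_\hbar h$ with $\ell\in\mathbb{N}_0$, $g_j\in\mathcal{B}_\hbar$, $h\in(\mathcal{B}_\hbar)_{\mathrm H}$; conversely every element of the right-hand side lies in $\mathcal{R}_{\hbar,\mu}$.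
   Context: $z_0,\dots,z_n,\overline{z_0},\dots,\overline{z_n}$ are the complex coordinates on $\mathbb{C}^{1+n}$ and their conjugates; for $K\in\mathbb{N}_0^{1+n}$, $z^K=z_0^{K_0}\cdots z_n^{K_n}$, $\overline{z}^K$ analogously, $|K|=\sum K_i$, $K!=\prod K_i!$. $\mathscr{P}^{k,\ell}(\mathbb{C}^{1+n})$ is the complex span of the $z^K\overline{z}^L$ with $|K|=k$, $|L|=\ell$, and $\mathscr{P}(\mathbb{C}^{1+n})=\bigoplus_{k,\ell}\mathscr{P}^{k,\ell}(\mathbb{C}^{1+n})$ is the space of complex polynomials on $\mathbb{C}^{1+n}$. The Wick star product is $f\star_\hbar g=\sum_{K\in\mathbb{N}_0^{1+n}}\frac{\hbar^{|K|}}{K!}\frac{\partial^{|K|}f}{\partial\overline{z}^K}\frac{\partial^{|K|}g}{\partial z^K}$; with pointwise complex conjugation as $^*$ this is a unital $^*$-algebra (unit the constant function $\mathbb{1}$). Juxtaposition of polynomials means pointwise product. $\mathcal{J}=\sum_{j=0}^n z_j\overline{z_j}$. For a $^*$-algebra $A$, $A_{\mathrm H}=\{a:a=a^*\}$, $A^{++}_{\mathrm H}$ is the set of finite sums $\sum a_j^*a_j$, and for a subset $S$, $S_{\mathrm H}=S\cap A_{\mathrm H}$. The Fock space is the space of holomorphic polynomials $\bigoplus_k\mathscr{P}^{k,0}(\mathbb{C}^{1+n})$ with inner product $\langle z^K,z^L\rangle_\hbar=\delta_{K,L}\hbar^{|K|}K!$ (antilinear in the first argument), and $\pi_\hbar$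 is the $^*$-representation of $(\mathscr{P}(\mathbb{C}^{1+n}),\star_\hbar)$ on it given by $\pi_\hbar(z^K\overline{z}^L)=z^K\hbar^{|L|}\frac{\partial^{|L|}}{\partial z^L}$. $\mathcal{B}_\hbar$ (which equals the commutant of $\mathcal{J}$ in $(\mathscr{P}(\mathbb{C}^{1+n}),\star_\hbar)$) is ordered by $\mathcal{B}^+_\hbar=\{f\in(\mathcal{B}_\hbar)_{\mathrm H}:\langle g,\pi_\hbar(f)g\rangle_\hbar\ge0\text{ for all }g\text{ in the Fock space}\}$. A state on $\mathcal{B}_\hbar$ is a linear $\omega:\mathcal{B}_\hbar\to\mathbb{C}$ with $\omega(\mathbb{1})=1$, $\omega$ real on Hermitian elements and $\omega\ge0$ on $\mathcal{B}^+_\hbar$. $\mathcal{R}_{\hbar,\mu}$ is the set of $f\in(\mathcal{B}_\hbar)_{\mathrm H}$ with $\omega(f)\ge0$ for every state $\omega$ on $\mathcal{B}_\hbar$ satisfying $\omega\big((\mathcal{J}-\mu\mathbb{1})\star_\hbar(\mathcal{J}-\mu\mathbb{1})\big)=0$ (the quadratic module of the reduction at $\mu$). *)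

(* Defs.v *)
From HB Require Import structures.
From mathcomp Require Import all_boot all_order all_algebra.
From mathcomp Require Import reals.
From mathcomp Require Import complex.
From mathcomp Require Import mpoly.

Set Implicit Arguments.
Unset Strict Implicit.
Unset Printing Implicit Defensive.

Import Order.TTheory GRing.Theory Num.Theory.
Local Open Scope ring_scope.

Section Wick.
Variables (R : realType) (n : nat).

Local Notation C := R[i].
Local Notation N := (n.+1 + n.+1)%N.
(* P(C^{1+n}): complex polynomials in z_0..z_n, zbar_0..zbar_n ;
   variable (lshift _ i) is z_i, variable (rshift _ i) is zbar_i *)
Definition WPoly := {mpoly C[N]}.
(* WFock space: holomorphic polynomials in z_0..z_n *)
Definition WFock := {mpoly C[n.+1]}.

Definition zvar (i : 'I_n.+1) : 'I_N := lshift n.+1 i.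
Definition zbvar (i : 'I_n.+1) : 'I_N := rshift n.+1 i.

Definition holo (m : 'X_{1..N}) : 'X_{1..n.+1} := [multinom m (zvar i) | i < n.+1].
Definition anti (m : 'X_{1..N}) : 'X_{1..n.+1} := [multinom m (zbvar i) | i < n.+1].

Definition zmon (K : 'X_{1..n.+1}) : 'X_{1..N} :=
  [multinom (match split j with inl i => K i | inr _ => 0%N end) | j < N].
Definition zbmon (K : 'X_{1..n.+1}) : 'X_{1..N} :=
  [multinom (match split j with inl _ => 0%N | inr i => K i end) | j < N].

Definition mfact (K : 'X_{1..n.+1}) : nat := (\prod_(i < n.+1) (K i)`!)%N.

(* the Wick star product; only K with |K| < msize f (i.e. |K| <= deg f) contribute *)
Definition wick (hb : R) (f g : WPoly) : WPoly :=
  \sum_(K : 'X_{1..n.+1 < msize f})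
     (((hb%:C)%C ^+ mdeg K / (mfact K)%:R) *:
        (mderivm (zbmon K) f * mderivm (zmon K) g)).

Definition swapvar (j : 'I_N) : 'I_N :=
  match split j with inl i => zbvar i | inr i => zvar i end.
Definition swapm (m : 'X_{1..N}) : 'X_{1..N} := [multinom m (swapvar j) | j < N].
Definition pconj (f : WPoly) : WPoly :=
  \sum_(m <- msupp f) ((f@_m)^* *: 'X_[swapm m]).

Definition wherm (f : WPoly) : Prop := pconj f = f.

Definition inB (f : WPoly) : Prop :=
  forall m, m \in msupp f -> mdeg (holo m) = mdeg (anti m).

Definition Jpoly : WPoly := \sum_(i < n.+1) ('X_[U_(zvar i)] * 'X_[U_(zbvar i)]).

Definition fock_inner (hb : R) (p q : WFock) : C :=
  \sum_(K <- msupp p) ((p@_K)^* * q@_K * (hb%:C)%C ^+ mdeg K * (mfact K)%:R).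

Definition piF (hb : R) (f : WPoly) (g : WFock) : WFock :=
  \sum_(m <- msupp f)
     ((f@_m * (hb%:C)%C ^+ mdeg (anti m)) *: ('X_[holo m] * mderivm (anti m) g)).

Definition Bplus (hb : R) (f : WPoly) : Prop :=
  inB f /\ wherm f /\ forall g : WFock, 0 <= fock_inner hb g (piF hb f g).

(* states on B_hbar (omega only matters on B_hbar) *)
Definition is_state (hb : R) (omega : WPoly -> C) : Prop :=
  [/\ (forall (a b : C) (f g : WPoly), inB f -> inB g ->
          omega (a *: f + b *: g) = a * omega f + b * omega g),
      omega 1 = 1,
      (forall f, inB f -> wherm f -> omega f \is Num.real) &
      (forall f, Bplus hb f -> 0 <= omega f)].

Definition Rred (hb mu : R) (f : WPoly) : Prop :=
  [/\ inB f, wherm f &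
      forall omega, is_state hb omega ->
        omega (wick hb (Jpoly - (mu%:C)%C%:MP) (Jpoly - (mu%:C)%C%:MP)) = 0 ->
        0 <= omega f].

Definition sosB (hb : R) (f : WPoly) : Prop :=
  exists s : seq WPoly, (forall a, a \in s -> inB a) /\
    f = \sum_(a <- s) wick hb (pconj a) a.

Definition in_star_ideal (hb : R) (x f : WPoly) : Prop :=
  exists s t : seq (WPoly * WPoly),
    (forall p, p \in s -> inB p.1 /\ inB p.2) /\
    (forall p, p \in t -> inB p.1 /\ inB p.2) /\
    f = \sum_(p <- s) wick hb p.1 (wick hb x p.2)
        + \sum_(p <- t) wick hb p.1 (wick hb (pconj x) p.2).

End Wick.

(* Main.v *)
(* Write X = J - mu. The inclusion of the right-hand side is Cauchy-Schwarz for states: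
   omega (X * X) = 0 forces omega (X * q) = 0, and X is central in B.

   Conversely, let QM be the sums of squares plus the Hermitian part of the ideal. Using
   n >= 1, the pointwise product p p^* lies in QM for every holomorphic p of degree at most
   k + 1 if mu = hbar k, and at most k + 2 if hbar k < mu < hbar (k + 1), although p is not
   in B. On the other hand J^e is congruent modulo X to
   mu (mu - hbar) ... (mu - hbar (e - 1)), and J^e is a sum of elements p p^*.
   If mu is strictly between hbar k and hbar (k + 1), then e = k + 2 gives -1 in QM, so QM
   is everything. If mu = hbar k, then e = k + 1 gives 0, so QM contains both signs of all
   p p^* with p of degree k + 1; hence every component of bidegree (d, d) with d > k lies
   in the (complexified) support of QM, which is an ideal. Components with d < k can be
   moved up to d = k by multiplication with J. So every element of B is congruent to some
   r of bidegree (k, k), and evaluating vector states on the degree k part of the Fock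
   space shows that the coefficient matrix of r is positive semidefinite, i.e. that r is
   a sum of elements p p^* with p of degree k. *)
Require Import Defs.
From HB Require Import structures.
From mathcomp Require Import all_boot all_order all_algebra.
From mathcomp Require Import reals.
From mathcomp Require Import complex.
From mathcomp Require Import ssrcomplements mpoly ring.
Set Implicit Arguments.
Unset Strict Implicit.
Unset Printing Implicit Defensive.
Import Order.TTheory GRing.Theory Num.Theory.
Local Open Scope ring_scope.

(** * Derivatives and multi-indices *)

Section PolynomialGenerics.
Variables (k : nat) (S : comNzRingType).
Implicit Types (p q : {mpoly S[k]}) (m : 'X_{1..k}).

Lemma multinom_ind (P : 'X_{1..k} -> Prop) :
  P 0%MM -> (forall i m, P m -> P (m + U_(i))%MM) -> forall m, P m.
Proof.
move=> P0 PS m; move: {2}(mdeg m) (erefl (mdeg m)) => d.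
elim: d m => [|d IH] m hd.
  by move/eqP: hd; rewrite mdeg_eq0 => /eqP ->.
have [i hi] : exists i, m i != 0%N.
  apply/existsP; apply/contraT; rewrite negb_exists => /forallP h0.
  move: hd; rewrite mdegE big1 // => i _; exact/eqP/negPn.
have hm : (U_(i) <= m)%MM by rewrite lep1mP.
rewrite -(submK hm); apply/PS/IH.
move: hd; rewrite -{1}(submK hm) mdegD mdeg1 addn1 => -[].
by [].
Qed.

Lemma mpoly_gen_ind (P : {mpoly S[k]} -> Prop) :
  (forall c p, P p -> P (c *: p)) -> (forall p q, P p -> P q -> P (p + q)) ->
  P 1 -> (forall i p, P p -> P ('X_i * p)) -> forall p, P p.
Proof.
move=> PZ PD P1 PX p; elim/mpolyind: p => [|c m p _ _ IH].
  by rewrite -(scale0r 1); apply: PZ.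
apply: PD => //; apply: PZ; elim/multinom_ind: m => [|i m Pm].
  by rewrite mpolyX0.
by rewrite mpolyXD mulrC; apply: PX.
Qed.

Lemma mderivU i j : ('X_j : {mpoly S[k]})^`M(i) = (i == j)%:R.
Proof.
rewrite mderivX mnm1E eq_sym; case: eqP => [->|_]; last by rewrite scale0r.
by rewrite scale1r -[X in (X - _)%MM]add0m addmK mpolyX0.
Qed.

(** Leibniz rule: only the first derivative of ['X_i] survives. For [m i = 0] the subtraction
    [m - U_(i)] truncates, but its coefficient vanishes. *)
Lemma mderivm_mulX i m p :
  ('X_i * p)^`M[m] = 'X_i * p^`M[m] + (m i)%:R *: p^`M[m - U_(i)].
Proof.
elim/multinom_ind: m => [|j m IH].
  by rewrite !mderivm0m mnm0E scale0r addr0.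
rewrite !mderivmDm IH !mderivmU1m linearD linearZ /= mderivM mderivU mnmDE mnm1E.
rewrite -addrA addrCA; congr (_ + _).
case: (eqVneq j i) => [->|ne].
  rewrite mul1r addmK natrD scalerDl scale1r addrC.
  case: (posnP (m i)) => [->|mi]; first by rewrite !scale0r.
  congr (_ + _); congr (_ *: _).
  by rewrite -mderivmU1m -mderivmDm submK // lep1mP -lt0n.
rewrite mul0r add0r addn0.
case: (posnP (m i)) => [->|mi]; first by rewrite !scale0r.
congr (_ *: _); rewrite -mderivmU1m -mderivmDm; congr mderivm.
apply/mnmP=> l; rewrite !(mnmBE, mnmDE) !mnm1E.
case: (eqVneq i l) => [<-|_]; last by rewrite !subn0.
by rewrite (negbTE ne) !addn0.
Qed.

Lemma mcoeff_mulX_mderiv i p m : ('X_i * p^`M(i))@_m = (m i)%:R * p@_m.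
Proof.
elim/mpolyind: p => [|c m' p _ _ IH]; first by rewrite mderiv0 mulr0 !mcoeff0 mulr0.
rewrite mderivD mulrDr !mcoeffD IH mulrDr; congr (_ + _).
rewrite mderivZ -scalerAr !mcoeffZ mulrCA; congr (_ * _).
rewrite mderivX -scalerAr mcoeffZ !mcoeffX -mpolyXD mcoeffX.
case: (posnP (m' i)) => [E|gt0].
  rewrite E mul0r; case: eqP => [<-|_]; last by rewrite mulr0.
  by rewrite E mul0r.
rewrite addmC submK; last by rewrite lep1mP -lt0n.
by case: eqP => [->//|_]; rewrite !mulr0.
Qed.

Lemma mderivm_small m p : (msize p <= mdeg m)%N -> p^`M[m] = 0.
Proof.
move=> le_pm; apply/mpolyP => m'; rewrite mcoeff_mderivm mcoeff0.
rewrite memN_msupp_eq0 ?mul0rn //; apply: msize_mdeg_ge.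
by rewrite mdegD (leq_trans le_pm) // leq_addr.
Qed.

(** The Wick product is summed over a range that depends on its left factor; this brings several
    such sums to a common range. *)
Lemma sum_bmnm_widen (V : nmodType) (F : 'X_{1..k} -> V) a b : (a <= b)%N ->
  (forall m, (a <= mdeg m)%N -> F m = 0) ->
  \sum_(m : 'X_{1..k < b}) F m = \sum_(m : 'X_{1..k < a}) F m.
Proof.
move=> le_ab F0; pose I : subFinType _ := 'X_{1..k < a}.
pose J : subFinType _ := 'X_{1..k < b}.
rewrite (bigID (fun m : 'X_{1..k < b} => (mdeg m < a)%N)) /=.
rewrite [X in _ + X]big1 ?addr0 => [|m]; last by rewrite -leqNgt => /F0.
symmetry.
rewrite (@big_sub_widen _ _ _ _ _ _ I J xpredT F) //= => m /leq_trans; exact.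
Qed.

(** Re-indexes the extra terms of the Leibniz rule, which carry a factor $K_i$ and therefore vanish
    when $K_i = 0$. *)
Lemma sum_bmnm_shift (V : nmodType) (F : 'X_{1..k} -> V) i b :
  (forall m, m i = 0%N -> F m = 0) ->
  \sum_(m : 'X_{1..k < b.+1}) F m = \sum_(m : 'X_{1..k < b}) F (m + U_(i))%MM.
Proof.
move=> F0; rewrite (bigID (fun m : 'X_{1..k < b.+1} => m i != 0%N)) /=.
rewrite [X in _ + X]big1 ?addr0 => [|m]; last by rewrite negbK => /eqP /F0.
have up (m : 'X_{1..k < b}) : (mdeg (m + U_(i))%MM < b.+1)%N.
  by rewrite mdegD mdeg1 addn1 ltnS bmdeg.
(* The bound zero is treated apart: the default value [bm0] of [insubd] below exists only in ranges
   with a positive bound. *)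
case: b F0 up => [|b] F0 up.
  rewrite [RHS]big1 => [|[m hm] //]; apply: big1 => m.
  by have := bmdeg m; rewrite ltnS leqn0 mdeg_eq0 => /eqP ->; rewrite mnm0E.
rewrite (reindex_onto (fun m : 'X_{1..k < b.+1} => BMultinom (up m))
  (fun m : 'X_{1..k < b.+2} => insubd (@bm0 k b) (m - U_(i))%MM)) /=; last first.
  move=> m mi; apply: val_inj => /=; rewrite val_insubd.
  have le : (U_(i) <= m)%MM by rewrite lep1mP.
  suff -> : (mdeg (m - U_(i))%MM < b.+1)%N by rewrite submK.
  by have := bmdeg m; rewrite -{1}(submK le) mdegD mdeg1 addn1 ltnS.
apply: eq_bigl => m; rewrite mnmDE mnm1E eqxx addn1 /=.
by apply/eqP/val_inj; rewrite val_insubd /= addmK bmdeg.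
Qed.

End PolynomialGenerics.

(** * The Wick product *)

Section WickProduct.
Variables (R : realType) (n : nat) (hb : R).
Local Notation C := R[i].
Local Notation WP := {mpoly C[n.+1 + n.+1]}.
Local Notation h := (hb%:C)%C.
Local Notation z i := ('X_(zvar i) : WP).
Local Notation zb i := ('X_(zbvar i) : WP).
Local Notation dz i := (mderiv (zvar i)).
Local Notation dzb i := (mderiv (zbvar i)).
Local Notation "f ⋆ g" := (wick hb f g) (at level 40, left associativity).
Implicit Types (f g : WP) (K : 'X_{1..n.+1}) (i j : 'I_n.+1) (c : C).

Lemma zmon_zvar K i : zmon K (zvar i) = K i.
Proof. by rewrite mnmE (unsplitK (inl i)). Qed.

Lemma zmon_zbvar K i : zmon K (zbvar i) = 0%N.
Proof. by rewrite mnmE (unsplitK (inr i)). Qed.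

Lemma zbmon_zvar K i : zbmon K (zvar i) = 0%N.
Proof. by rewrite mnmE (unsplitK (inl i)). Qed.

Lemma zbmon_zbvar K i : zbmon K (zbvar i) = K i.
Proof. by rewrite mnmE (unsplitK (inr i)). Qed.

Lemma eq_zvar_zbvar i j : (zvar i == zbvar j) = false.
Proof. by rewrite /zvar /zbvar eq_lrshift. Qed.

Lemma eq_zbvar_zvar i j : (zbvar i == zvar j) = false.
Proof. by rewrite /zvar /zbvar eq_rlshift. Qed.

Lemma eq_zvar i j : (zvar i == zvar j) = (i == j).
Proof. by rewrite /zvar eq_lshift. Qed.

Lemma eq_zbvar i j : (zbvar i == zbvar j) = (i == j).
Proof. by rewrite /zbvar eq_rshift. Qed.

Lemma var_ind (P : 'I_(n.+1 + n.+1) -> Prop) :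
  (forall i, P (zvar i)) -> (forall i, P (zbvar i)) -> forall l, P l.
Proof.
move=> Pz Pb l; rewrite -(@splitK n.+1 n.+1 l); case: (split l) => i; [apply: Pz|apply: Pb].
Qed.

Definition varE := (eq_zvar_zbvar, eq_zbvar_zvar, eq_zvar, eq_zbvar,
  zmon_zvar, zmon_zbvar, zbmon_zvar, zbmon_zbvar, @mnmDE n.+1, @mnm1E n.+1,
  @mnmDE (n.+1 + n.+1), @mnm1E (n.+1 + n.+1)).

Lemma zmonD1 K i : zmon (K + U_(i)) = (zmon K + U_(zvar i))%MM.
Proof. by apply/mnmP; elim/var_ind => j; rewrite !varE. Qed.

Lemma zbmonD1 K i : zbmon (K + U_(i)) = (zbmon K + U_(zbvar i))%MM.
Proof. by apply/mnmP; elim/var_ind => j; rewrite !varE. Qed.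

Lemma mdeg_zmon K : mdeg (zmon K) = mdeg K.
Proof.
rewrite !mdegE big_split_ord /= [X in (_ + X)%N]big1 ?addn0 => [|i _].
  by apply: eq_bigr => i _; rewrite zmon_zvar.
by rewrite zmon_zbvar.
Qed.

Lemma mdeg_zbmon K : mdeg (zbmon K) = mdeg K.
Proof.
rewrite !mdegE big_split_ord /= [X in (X + _)%N]big1 ?add0n => [|i _].
  by apply: eq_bigr => i _; rewrite zbmon_zbvar.
by rewrite zbmon_zvar.
Qed.

Lemma mfactD1 K i : mfact (K + U_(i)) = ((K i).+1 * mfact K)%N.
Proof.
rewrite /mfact (bigD1 i) //= [in RHS](bigD1 i) //= !varE eqxx addn1 factS mulnA.
congr (_ * _)%N; apply: eq_bigr => j ne; rewrite !varE eq_sym (negbTE ne).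
by rewrite addn0.
Qed.

Lemma mfact_neq0 K : (mfact K)%:R != 0 :> C.
Proof.
by rewrite pnatr_eq0 -lt0n prodn_gt0 // => i; rewrite fact_gt0.
Qed.

Lemma wickwE b f g : (msize f <= b)%N -> f ⋆ g =
  \sum_(K : 'X_{1..n.+1 < b}) (h ^+ mdeg K / (mfact K)%:R) *:
     (f^`M[zbmon K] * g^`M[zmon K]).
Proof.
move=> le_fb; rewrite /wick.
apply/esym/(@sum_bmnm_widen _ _ (fun K => (h ^+ mdeg K / (mfact K)%:R) *:
     (f^`M[zbmon K] * g^`M[zmon K])) _ _ le_fb).
by move=> K hK; rewrite mderivm_small ?mdeg_zbmon // mul0r scaler0.
Qed.

Lemma wick_linear_l g : linear (fun f => f ⋆ g).
Proof.
move=> c f f'; pose b := maxn (msize (c *: f + f')) (maxn (msize f) (msize f')).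
have [hb1 hb2 hb3] : [/\ msize (c *: f + f') <= b, msize f <= b & msize f' <= b]%N.
  by split; rewrite /b !leq_max leqnn ?orbT.
rewrite !(@wickwE b) // scaler_sumr -big_split; apply: eq_bigr => K _ /=.
by rewrite linearP /= mulrDl -scalerAl scalerDr !scalerA [_ * c]mulrC.
Qed.

Lemma wick_linear_r f : linear (wick hb f).
Proof.
move=> c g g'; rewrite /wick scaler_sumr -big_split; apply: eq_bigr => K _ /=.
by rewrite linearP /= mulrDr -scalerAr scalerDr !scalerA [_ * c]mulrC.
Qed.

HB.instance Definition _ f :=
  GRing.isLinear.Build C WP WP _ (wick hb f) (wick_linear_r f).

Lemma wick0r f : f ⋆ 0 = 0. Proof. exact: linear0. Qed.
Lemma wickDr f g g' : f ⋆ (g + g') = f ⋆ g + f ⋆ g'. Proof. exact: linearD. Qed.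
Lemma wickBr f g g' : f ⋆ (g - g') = f ⋆ g - f ⋆ g'. Proof. exact: linearB. Qed.
Lemma wickZr c f g : f ⋆ (c *: g) = c *: (f ⋆ g). Proof. exact: linearZ. Qed.
Lemma wick_sumr (I : Type) (r : seq I) P (F : I -> WP) f :
  f ⋆ (\sum_(i <- r | P i) F i) = \sum_(i <- r | P i) f ⋆ F i.
Proof. exact: linear_sum. Qed.

(** Arguments swapped, to carry the linear structure in the left factor. *)
Definition wickr g f := f ⋆ g.

HB.instance Definition _ g :=
  GRing.isLinear.Build C WP WP _ (wickr g) (wick_linear_l g).

Lemma wick0l g : 0 ⋆ g = 0. Proof. exact: (linear0 (wickr g)). Qed.
Lemma wickDl f f' g : (f + f') ⋆ g = f ⋆ g + f' ⋆ g.
Proof. exact: (linearD (wickr g)). Qed.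
Lemma wickBl f f' g : (f - f') ⋆ g = f ⋆ g - f' ⋆ g.
Proof. exact: (linearB (wickr g)). Qed.
Lemma wickZl c f g : (c *: f) ⋆ g = c *: (f ⋆ g).
Proof. exact: (linearZ_LR (wickr g)). Qed.
Lemma wick_suml (I : Type) (r : seq I) P (F : I -> WP) g :
  (\sum_(i <- r | P i) F i) ⋆ g = \sum_(i <- r | P i) F i ⋆ g.
Proof. exact: (linear_sum (wickr g)). Qed.

Lemma mderivm_one (m : 'X_{1..n.+1 + n.+1}) : m != 0%MM -> (1 : WP)^`M[m] = 0.
Proof.
by move=> m0; rewrite mderivm_small // msize1 lt0n mdeg_eq0.
Qed.

Lemma wick_term0 f g (K : 'X_{1..n.+1}) : K = 0%MM ->
  (h ^+ mdeg K / (mfact K)%:R) *: (f^`M[zbmon K] * g^`M[zmon K]) = f * g.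
Proof.
move=> ->; rewrite mdeg0 expr0.
have -> : mfact (0%MM : 'X_{1..n.+1}) = 1%N by rewrite /mfact big1 // => i _; rewrite mnm0E.
have -> : zbmon (0%MM : 'X_{1..n.+1}) = 0%MM.
  by apply/eqP; rewrite -mdeg_eq0 mdeg_zbmon mdeg0.
have -> : zmon (0%MM : 'X_{1..n.+1}) = 0%MM.
  by apply/eqP; rewrite -mdeg_eq0 mdeg_zmon mdeg0.
by rewrite divr1 !mderivm0m scale1r.
Qed.

Lemma wick1l g : 1 ⋆ g = g.
Proof.
rewrite (@wickwE 1) ?msize1 // (bigD1 bm0) //= wick_term0 // mul1r big1 ?addr0 //.
move=> K ne; rewrite mderivm_one ?mul0r ?scaler0 // -mdeg_eq0 mdeg_zbmon.
by rewrite mdeg_eq0.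
Qed.

Lemma wick1r f : f ⋆ 1 = f.
Proof.
rewrite (@wickwE (msize f).+1) // (bigD1 bm0) //= wick_term0 // mulr1 big1 ?addr0 //.
move=> K ne; rewrite [1^`M[_]]mderivm_one ?mulr0 ?scaler0 // -mdeg_eq0 mdeg_zmon.
by rewrite mdeg_eq0.
Qed.

(** The left factor is differentiated only in the $\bar z$ variables, so [z i] passes through. *)
Lemma wick_zl i f g : (z i * f) ⋆ g = z i * (f ⋆ g).
Proof.
pose b := maxn (msize (z i * f)) (msize f).
rewrite !(@wickwE b) ?leq_max ?leqnn ?orbT // mulr_sumr; apply: eq_bigr => K _.
by rewrite mderivm_mulX varE scale0r addr0 -scalerAr mulrA.
Qed.

Lemma wick_zbr i f g : f ⋆ (zb i * g) = zb i * (f ⋆ g).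
Proof.
rewrite /wick mulr_sumr; apply: eq_bigr => K _.
by rewrite mderivm_mulX varE scale0r addr0 -scalerAr mulrCA.
Qed.

Lemma wick_shift_coef K i :
  h ^+ mdeg (K + U_(i)) / (mfact (K + U_(i)))%:R * (K i).+1%:R
  = h ^+ mdeg K / (mfact K)%:R * h.
Proof.
rewrite mdegD mdeg1 mfactD1 addn1 exprSr mulnC natrM invfM mulrA.
by rewrite mulfVK ?pnatr_eq0 // mulrAC.
Qed.

(** The Leibniz rule gives one extra family of terms; shifting $K$ by [U_(i)] turns it into the
    summand with [dz i g]. Together with [wick_zl] this is a recursion on the left factor, by which
    the algebraic identities below are proved. *)
Lemma wick_zbl i f g : (zb i * f) ⋆ g = f ⋆ (zb i * g + h *: dz i g).
Proof.
pose b := maxn (msize (zb i * f)) (msize f).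
rewrite (@wickwE b.+1); last by rewrite (leq_trans _ (leqnSn b)) // leq_maxl.
under eq_bigr => K _ do
  rewrite mderivm_mulX zbmon_zbvar mulrDl scalerDr -!scalerAl -mulrA.
rewrite big_split /= wickDr wick_zbr wickZr; congr (_ + _).
  rewrite (@wickwE b.+1) ?mulr_sumr; last first.
    by rewrite (leq_trans _ (leqnSn b)) // leq_maxr.
  by apply: eq_bigr => K _; rewrite -scalerAr.
rewrite (@sum_bmnm_shift _ _ (fun K => (h ^+ mdeg K / (mfact K)%:R) *:
  ((K i)%:R *: (f^`M[zbmon K - U_(zbvar i)] * g^`M[zmon K]))) i); last first.
  by move=> K ->; rewrite scale0r scaler0.
rewrite (@wickwE b) ?leq_maxr // scaler_sumr; apply: eq_bigr => K _.
rewrite zbmonD1 zmonD1 addmK !scalerA !varE eqxx addn1 wick_shift_coef.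
rewrite [h * _]mulrC; congr (_ *: (_ * _)).
by rewrite addmC mderivmDm mderivmU1m.
Qed.

Lemma wick_zr i f g : f ⋆ (z i * g) = (z i * f + h *: dzb i f) ⋆ g.
Proof.
pose b := maxn (msize (dzb i f)) (msize f).
have hbf : (msize f <= b.+1)%N by rewrite (leq_trans _ (leqnSn b)) // leq_maxr.
rewrite (@wickwE b.+1) //.
under eq_bigr => K _ do
  rewrite mderivm_mulX zmon_zvar mulrDr scalerDr -!scalerAr mulrCA.
rewrite big_split /= wickDl wick_zl wickZl; congr (_ + _).
  rewrite (@wickwE b.+1) ?mulr_sumr //.
  by apply: eq_bigr => K _; rewrite -scalerAr.
rewrite (@sum_bmnm_shift _ _ (fun K => (h ^+ mdeg K / (mfact K)%:R) *:
  ((K i)%:R *: (f^`M[zbmon K] * g^`M[zmon K - U_(zvar i)]))) i); last first.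
  by move=> K ->; rewrite scale0r scaler0.
rewrite (@wickwE b) ?leq_maxl // scaler_sumr; apply: eq_bigr => K _.
rewrite zbmonD1 zmonD1 addmK !scalerA !varE eqxx addn1 wick_shift_coef.
rewrite [h * _]mulrC; congr (_ *: (_ * _)).
by rewrite addmC mderivmDm mderivmU1m.
Qed.

(* Unification otherwise tries to unfold polynomial arithmetic and diverges in practice. *)
Opaque wick mderiv mpoly_mul mpoly_add mpoly_scale mpoly_opp.

Lemma wpoly_ind (P : WP -> Prop) :
  (forall c f, P f -> P (c *: f)) -> (forall f g, P f -> P g -> P (f + g)) ->
  P 1 -> (forall i f, P f -> P (z i * f)) -> (forall i f, P f -> P (zb i * f)) ->
  forall f, P f.
Proof.
move=> PZ PD P1 Pz Pb; apply: mpoly_gen_ind => //.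
by elim/var_ind => i f; [apply: Pz|apply: Pb].
Qed.

Lemma mderiv_wick l f g : (f ⋆ g)^`M(l) = f^`M(l) ⋆ g + f ⋆ g^`M(l).
Proof.
elim/wpoly_ind: f g => [c f IH|f f' IH IH'||i f IH|i f IH] g.
- by rewrite wickZl !mderivZ IH !wickZl -scalerDr.
- by rewrite wickDl !mderivD IH IH' !wickDl addrACA.
- by rewrite !wick1l -mpolyC1 mderivC wick0l add0r.
- rewrite wick_zl !mderivM IH wickDl !wick_zl mulrDr addrA; congr (_ + _ + _).
  by rewrite mderivU; case: (_ == _); rewrite ?mul0r ?wick0l // !mul1r.
rewrite wick_zbl IH mderivD mderivZ !mderivM mderivU wickDl wick_zbl.
rewrite [mderiv l (dz i g)]mderiv_comm.
have E : f ⋆ ((l == zbvar i)%:R * g) = ((l == zbvar i)%:R * f) ⋆ g.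
  by case: (l == _); rewrite ?mul0r ?wick0l ?wick0r // !mul1r.
rewrite !wick_zbl -[(l == zbvar i)%:R * g + _ + _]addrA.
by rewrite [f ⋆ ((l == _)%:R * g + _)]wickDr E addrCA addrA.
Qed.

(** In the recursion on [f], a factor [zb i] reaches [g ⋆ k] as [zb i] plus [h] times [dz i], and
    [dz i] is a derivation of the Wick product. *)
Lemma wickA f g k : f ⋆ (g ⋆ k) = (f ⋆ g) ⋆ k.
Proof.
elim/wpoly_ind: f g => [c f IH|f f' IH IH'||i f IH|i f IH] g.
- by rewrite !wickZl IH.
- by rewrite !wickDl IH IH'.
- by rewrite !wick1l.
- by rewrite !wick_zl IH.
rewrite !wick_zbl -IH; congr (_ ⋆ _).
by rewrite wickDl wickZl wick_zbl mderiv_wick wickDr wickZr wick_zbr scalerDr addrA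
  -addrA [_ *: _ + _]addrC addrA addrAC.
Qed.

End WickProduct.

Opaque wick mderiv mpoly_mul mpoly_add mpoly_scale mpoly_opp.

(** * Involution, bidegrees and the commutant of J *)

Section Involution.
Variables (R : realType) (n : nat) (hb : R).
Local Notation C := R[i].
Local Notation WP := {mpoly C[n.+1 + n.+1]}.
Local Notation h := (hb%:C)%C.
Local Notation z i := ('X_(zvar i) : WP).
Local Notation zb i := ('X_(zbvar i) : WP).
Local Notation dz i := (mderiv (zvar i)).
Local Notation dzb i := (mderiv (zbvar i)).
Local Notation "f ⋆ g" := (wick hb f g) (at level 40, left associativity).
Local Notation J := (Jpoly R n).
Implicit Types (f g : WP) (K : 'X_{1..n.+1}) (i j : 'I_n.+1) (c : C)
  (m : 'X_{1..n.+1 + n.+1}).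

Lemma swapvar_zvar i : swapvar (zvar i) = zbvar i.
Proof. by rewrite /swapvar (unsplitK (inl i)). Qed.

Lemma swapvar_zbvar i : swapvar (zbvar i) = zvar i.
Proof. by rewrite /swapvar (unsplitK (inr i)). Qed.

Lemma swapvarK : involutive (@swapvar n).
Proof. by elim/var_ind => i; rewrite !(swapvar_zvar, swapvar_zbvar). Qed.

Lemma swapmE m l : swapm m l = m (swapvar l).
Proof. by rewrite mnmE. Qed.

Lemma swapmK : involutive (@swapm n).
Proof. by move=> m; apply/mnmP => l; rewrite !swapmE swapvarK. Qed.

Lemma swapm0 : swapm 0%MM = 0%MM :> 'X_{1..n.+1 + n.+1}.
Proof. by apply/mnmP => l; rewrite swapmE !mnm0E. Qed.

Lemma swapmD m1 m2 : swapm (m1 + m2) = (swapm m1 + swapm m2)%MM.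
Proof. by apply/mnmP => l; rewrite swapmE !mnmDE !swapmE. Qed.

Lemma swapmU l : swapm U_(l) = (U_(swapvar l))%MM :> 'X_{1..n.+1 + n.+1}.
Proof.
by apply/mnmP => l'; rewrite swapmE !mnm1E (can2_eq (@swapvarK) (@swapvarK)).
Qed.

Lemma mcoeff_pconj f m : (pconj f)@_m = (f@_(swapm m))^*.
Proof.
rewrite /pconj raddf_sum /=.
under eq_bigr => m' _ do rewrite mcoeffZ mcoeffX.
case: (boolP (swapm m \in msupp f)) => hm.
  rewrite (bigD1_seq (swapm m)) ?msupp_uniq //= swapmK eqxx mulr1.
  rewrite big1 ?addr0 // => m' ne.
  by rewrite (can2_eq (@swapmK) (@swapmK)) (negbTE ne) mulr0.
rewrite (memN_msupp_eq0 hm) conjC0 big_seq big1 // => m' hm'.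
case: eqP hm => [<-|_ _]; last by rewrite mulr0.
by rewrite swapmK hm'.
Qed.

Lemma pconjD f g : pconj (f + g) = pconj f + pconj g.
Proof.
by apply/mpolyP => m; rewrite !(mcoeffD, mcoeff_pconj) rmorphD.
Qed.

Lemma pconjZ c f : pconj (c *: f) = c^* *: pconj f.
Proof. by apply/mpolyP => m; rewrite !(mcoeffZ, mcoeff_pconj) rmorphM. Qed.

Lemma pconjN f : pconj (- f) = - pconj f.
Proof.
by rewrite -(scaleN1r f) pconjZ rmorphN1 scaleN1r.
Qed.

Lemma pconjB f g : pconj (f - g) = pconj f - pconj g.
Proof. by rewrite pconjD pconjN. Qed.

Lemma pconj0 : pconj (0 : WP) = 0.
Proof. by have := pconjZ 0 0; rewrite conjC0 !scale0r. Qed.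

Lemma pconj_sum (I : Type) (r : seq I) P (F : I -> WP) :
  pconj (\sum_(i <- r | P i) F i) = \sum_(i <- r | P i) pconj (F i).
Proof. exact: (big_morph _ pconjD pconj0). Qed.

Lemma pconjK f : pconj (pconj f) = f.
Proof. by apply/mpolyP => m; rewrite !mcoeff_pconj swapmK conjCK. Qed.

Lemma pconjX m : pconj ('X_[m] : WP) = 'X_[swapm m].
Proof.
apply/mpolyP => m'; rewrite mcoeff_pconj !mcoeffX conjC_nat.
by rewrite -(can2_eq (@swapmK) (@swapmK)).
Qed.

Lemma pconj1 : pconj (1 : WP) = 1.
Proof. by rewrite -mpolyX0 pconjX swapm0. Qed.

Lemma pconjM f g : pconj (f * g) = pconj f * pconj g.
Proof.
elim/mpolyind: f => [|c m f _ _ IH]; first by rewrite mul0r pconj0 mul0r.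
rewrite mulrDl !pconjD mulrDl IH; congr (_ + _).
rewrite -scalerAl !pconjZ -scalerAl; congr (_ *: _).
elim/mpolyind: g {IH} => [|c' m' g _ _ IH']; first by rewrite mulr0 pconj0 mulr0.
rewrite mulrDr !pconjD mulrDr IH'; congr (_ + _).
rewrite -scalerAr !pconjZ -scalerAr; congr (_ *: _).
by rewrite -mpolyXD !pconjX swapmD mpolyXD.
Qed.

Lemma pconj_z i : pconj (z i) = zb i.
Proof. by rewrite pconjX swapmU swapvar_zvar. Qed.

Lemma pconj_zb i : pconj (zb i) = z i.
Proof. by rewrite pconjX swapmU swapvar_zbvar. Qed.

Lemma pconj_mderiv l f : pconj (f^`M(l)) = (pconj f)^`M(swapvar l).
Proof.
apply/mpolyP => m; rewrite !(mcoeff_pconj, mcoeff_mderiv) swapmD swapmU swapvarK.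
by rewrite rmorphMn swapmE.
Qed.

Lemma conj_hb : h^* = h.
Proof. by apply/CrealP; rewrite complex_real. Qed.

(** Conjugation turns the recursion on the left factor into the one on the right factor, [wick_zl]
    into [wick_zbr] and [wick_zbl] into [wick_zr]. *)
Lemma pconj_wick f g : pconj (f ⋆ g) = pconj g ⋆ pconj f.
Proof.
elim/wpoly_ind: f g => [c f IH|f f' IH IH'||i f IH|i f IH] g.
- by rewrite wickZl !pconjZ IH wickZr.
- by rewrite wickDl !pconjD IH IH' wickDr.
- by rewrite wick1l pconj1 wick1r.
- by rewrite wick_zl !pconjM IH !pconj_z wick_zbr.
rewrite wick_zbl IH pconjD pconjZ !pconjM !pconj_zb pconj_mderiv.
by rewrite swapvar_zvar conj_hb wick_zr.
Qed.

(** [J] is linear in the $\bar z_i$, so only $|K| \le 1$ contributes, and the terms with $|K| = 1$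
    form the Euler operator in $z$. *)
Lemma wick_Jl f : J ⋆ f = J * f + h *: \sum_i z i * dz i f.
Proof.
rewrite /Jpoly wick_suml mulr_suml scaler_sumr -big_split /=.
apply: eq_bigr => i _; rewrite wick_zl -[zb i]mulr1 wick_zbl wick1l mulr1.
by rewrite mulrDr mulrA -scalerAr.
Qed.

Lemma wick_Jr f : f ⋆ J = J * f + h *: \sum_i zb i * dzb i f.
Proof.
rewrite /Jpoly wick_sumr mulr_suml scaler_sumr -big_split /=.
apply: eq_bigr => i _; rewrite mulrC wick_zbr -[z i]mulr1 wick_zr wick1r mulr1.
by rewrite mulrDr mulrA -scalerAr.
Qed.

Lemma mdeg_holo m : mdeg (holo m) = (\sum_i m (zvar i))%N.
Proof. by rewrite mdegE; apply: eq_bigr => i _; rewrite mnmE. Qed.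

Lemma mdeg_anti m : mdeg (anti m) = (\sum_i m (zbvar i))%N.
Proof. by rewrite mdegE; apply: eq_bigr => i _; rewrite mnmE. Qed.

Lemma mcoeff_eulerz f m :
  (\sum_i z i * dz i f)@_m = (mdeg (holo m))%:R * f@_m.
Proof.
rewrite raddf_sum mdeg_holo natr_sum mulr_suml; apply: eq_bigr => i _.
exact: mcoeff_mulX_mderiv.
Qed.

Lemma mcoeff_eulerzb f m :
  (\sum_i zb i * dzb i f)@_m = (mdeg (anti m))%:R * f@_m.
Proof.
rewrite raddf_sum mdeg_anti natr_sum mulr_suml; apply: eq_bigr => i _.
exact: mcoeff_mulX_mderiv.
Qed.

(** The space $\mathscr{P}^{a,b}$, described by supports so that zero belongs to every bidegree. *)
Definition bihom a b f :=
  forall m, m \in msupp f -> mdeg (holo m) = a /\ mdeg (anti m) = b.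

Lemma eulerz a b f : bihom a b f -> \sum_i z i * dz i f = a%:R *: f.
Proof.
move=> hf; apply/mpolyP => m; rewrite mcoeff_eulerz mcoeffZ.
case: (boolP (m \in msupp f)) => [/hf[-> _]//|/memN_msupp_eq0 ->].
by rewrite !mulr0.
Qed.

Lemma eulerzb a b f : bihom a b f -> \sum_i zb i * dzb i f = b%:R *: f.
Proof.
move=> hf; apply/mpolyP => m; rewrite mcoeff_eulerzb mcoeffZ.
case: (boolP (m \in msupp f)) => [/hf[_ ->]//|/memN_msupp_eq0 ->].
by rewrite !mulr0.
Qed.

Lemma wick_Jl_bihom a b f : bihom a b f -> J ⋆ f = J * f + (h * a%:R) *: f.
Proof. by move=> hf; rewrite wick_Jl (eulerz hf) scalerA. Qed.

Lemma wick_Jr_bihom a b f : bihom a b f -> f ⋆ J = J * f + (h * b%:R) *: f.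
Proof. by move=> hf; rewrite wick_Jr (eulerzb hf) scalerA. Qed.

Lemma wick_J_comm_bihom a b f : bihom a b f ->
  J ⋆ f = f ⋆ J + (h * (a%:R - b%:R)) *: f.
Proof.
move=> hf; rewrite (wick_Jl_bihom hf) (wick_Jr_bihom hf) mulrBr scalerBl.
by rewrite [X in _ = _ + X]addrC addrA addrK.
Qed.

Lemma bihomD a b f g : bihom a b f -> bihom a b g -> bihom a b (f + g).
Proof.
by move=> hf hg m /msuppD_le; rewrite mem_cat => /orP[/hf|/hg].
Qed.

Lemma bihomZ a b c f : bihom a b f -> bihom a b (c *: f).
Proof. by move=> hf m /msuppZ_le /hf. Qed.

Lemma bihom0 a b : bihom a b 0.
Proof. by move=> m; rewrite msupp0. Qed.

Lemma bihom_sum a b (I : eqType) (r : seq I) (F : I -> WP) :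
  (forall x, x \in r -> bihom a b (F x)) -> bihom a b (\sum_(i <- r) F i).
Proof.
move=> hF; rewrite big_seq; apply: big_ind => //; first exact: bihom0.
exact: bihomD.
Qed.

Lemma bihom_mulX a b l f m : bihom a b f ->
  m \in msupp ('X_l * f) -> exists2 m', bihom a b 'X_[m'] & m = (m' + U_(l))%MM.
Proof.
move=> hf; rewrite mulrC (perm_mem (msuppMX _ _)) => /mapP[m' /hf hm' ->].
by exists m'; [move=> m2; rewrite msuppX inE => /eqP -> | rewrite addmC].
Qed.

Lemma bihomX m : bihom (mdeg (holo m)) (mdeg (anti m)) 'X_[m].
Proof. by move=> m'; rewrite msuppX inE => /eqP ->. Qed.

Lemma bihom_z a b i f : bihom a b f -> bihom a.+1 b (z i * f).
Proof.
move=> hf m /(bihom_mulX hf)[m' hm' ->].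
have [|ha hb'] := hm' m'; first by rewrite msuppX inE.
move: ha hb'; rewrite !mdeg_holo !mdeg_anti => <- <-; split.
  under eq_bigr => j _ do rewrite mnmDE mnm1E eq_zvar.
  rewrite big_split /= (bigD1 i) //= [X in (_ + X)%N](bigD1 i) //=.
  rewrite eqxx [X in (1 + X)%N]big1 ?addn0 ?addn1 // => j.
  by rewrite eq_sym => /negbTE ->.
by apply: eq_bigr => j _; rewrite mnmDE mnm1E eq_zvar_zbvar addn0.
Qed.

Lemma holo_swap m : holo (swapm m) = anti m.
Proof. by apply/mnmP => i; rewrite !mnmE swapvar_zvar. Qed.

Lemma anti_swap m : anti (swapm m) = holo m.
Proof. by apply/mnmP => i; rewrite !mnmE swapvar_zbvar. Qed.

Lemma mem_msupp_pconj f m : (m \in msupp (pconj f)) = (swapm m \in msupp f).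
Proof. by rewrite !mcoeff_msupp mcoeff_pconj fmorph_eq0. Qed.

Lemma bihom_pconj a b f : bihom a b f -> bihom b a (pconj f).
Proof.
by move=> hf m; rewrite mem_msupp_pconj => /hf[]; rewrite holo_swap anti_swap.
Qed.

Lemma bihom_zb a b i f : bihom a b f -> bihom a b.+1 (zb i * f).
Proof.
move=> hf; rewrite -[zb i * f]pconjK pconjM pconj_zb.
exact/bihom_pconj/bihom_z/bihom_pconj.
Qed.

Lemma bihom1 : bihom 0 0 1.
Proof.
move=> m; rewrite msupp1 inE => /eqP ->.
by rewrite mdeg_holo mdeg_anti !big1 // => i _; rewrite mnm0E.
Qed.

Lemma bihomJ a b f : bihom a b f -> bihom a.+1 b.+1 (J * f).
Proof.
move=> hf; rewrite /Jpoly mulr_suml; apply: bihom_sum => i _.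
by rewrite -mulrA; exact/bihom_z/bihom_zb.
Qed.

Lemma inB_bihom d f : bihom d d f -> inB f.
Proof. by move=> hf m /hf[-> ->]. Qed.

Lemma pconjJ : pconj J = J.
Proof.
rewrite /Jpoly pconj_sum; apply: eq_bigr => i _.
by rewrite pconjM pconj_z pconj_zb mulrC.
Qed.

Hypothesis hhb : 0 < hb.

Lemma h_gt0 : 0 < h. Proof. by rewrite ltcR. Qed.

(* The commutator with J is the difference of the two Euler operators. As the
   commutant of J, B is closed under the product by associativity alone. *)
Lemma inB_commJ f : inB f <-> J ⋆ f = f ⋆ J.
Proof.
rewrite wick_Jl wick_Jr; split=> [hf|].
  congr (_ + _ *: _); apply/mpolyP => m; rewrite mcoeff_eulerz mcoeff_eulerzb.
  case: (boolP (m \in msupp f)) => [/hf ->//|/memN_msupp_eq0 ->].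
  by rewrite !mulr0.
move/addrI/(scalerI (lt0r_neq0 h_gt0))/mpolyP => E m; rewrite mcoeff_msupp => hm.
have := E m; rewrite mcoeff_eulerz mcoeff_eulerzb => /(mulIf hm)/eqP.
by rewrite eqr_nat => /eqP.
Qed.

Lemma inB_wick f g : inB f -> inB g -> inB (f ⋆ g).
Proof.
rewrite !inB_commJ => hf hg.
by rewrite wickA hf -wickA hg wickA.
Qed.

Lemma inB_pconj f : inB f -> inB (pconj f).
Proof. by move=> hf m; rewrite mem_msupp_pconj => /hf; rewrite holo_swap anti_swap. Qed.

Lemma inBD f g : inB f -> inB g -> inB (f + g).
Proof. by move=> hf hg m /msuppD_le; rewrite mem_cat => /orP[/hf|/hg]. Qed.

Lemma inBZ c f : inB f -> inB (c *: f).
Proof. by move=> hf m /msuppZ_le /hf. Qed.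

Lemma inBN f : inB f -> inB (- f).
Proof. by rewrite -scaleN1r; apply: inBZ. Qed.

Lemma inBB f g : inB f -> inB g -> inB (f - g).
Proof. by move=> hf hg; apply/inBD/inBN. Qed.

Lemma inB0 : inB (0 : WP).
Proof. by move=> m; rewrite msupp0. Qed.

Lemma inB1 : inB (1 : WP).
Proof. exact/inB_bihom/bihom1. Qed.

Lemma inB_sum (I : eqType) (r : seq I) (F : I -> WP) :
  (forall x, x \in r -> inB (F x)) -> inB (\sum_(i <- r) F i).
Proof.
move=> hF; rewrite big_seq; apply: big_ind => //; first exact: inB0.
exact: inBD.
Qed.

Lemma inBJ : inB J.
Proof. by apply/inB_commJ. Qed.

End Involution.

(** * Fock representation and states *)

Section Fock.
Variables (R : realType) (n : nat) (hb : R).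
Hypothesis hhb : 0 < hb.
Local Notation C := R[i].
Local Notation WP := {mpoly C[n.+1 + n.+1]}.
Local Notation FP := {mpoly C[n.+1]}.
Local Notation h := (hb%:C)%C.
Local Notation z i := ('X_(zvar i) : WP).
Local Notation zb i := ('X_(zbvar i) : WP).
Local Notation dz i := (mderiv (zvar i)).
Local Notation "f ⋆ g" := (wick hb f g) (at level 40, left associativity).
Local Notation J := (Jpoly R n).
Implicit Types (f g : WP) (p q : FP) (K : 'X_{1..n.+1}) (i j : 'I_n.+1) (c : C)
  (m : 'X_{1..n.+1 + n.+1}).

(** The squared norm of the monomial $z^K$ in the Fock space. *)
Definition fock_weight K : C := h ^+ mdeg K * (mfact K)%:R.

Lemma fock_weight_gt0 K : 0 < fock_weight K.
Proof.
by rewrite mulr_gt0 ?exprn_gt0 ?h_gt0 // lt0r mfact_neq0 ler0n.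
Qed.

(** The inner product is summed over the support of its first argument only; a common range makes
    its conjugate symmetry visible. *)
Lemma fock_innerwE b p q : (msize p <= b)%N -> fock_inner hb p q =
  \sum_(K : 'X_{1..n.+1 < b}) (p@_K)^* * q@_K * fock_weight K.
Proof.
move=> le_pb; pose I : subFinType _ := 'X_{1..n.+1 < b}.
rewrite /fock_inner (big_mksub I) /=; first last.
  by move=> x /msize_mdeg_lt/leq_trans/(_ le_pb).
  by rewrite msupp_uniq.
rewrite big_rmcond /= => [|K /memN_msupp_eq0 ->]; last by rewrite conjC0 !mul0r.
by apply: eq_bigr => K _; rewrite -mulrA.
Qed.

Lemma fock_inner_linear p : scalar (fock_inner hb p).
Proof.
move=> c q q'; rewrite /fock_inner mulr_sumr -big_split.
by apply: eq_bigr => K _ /=; rewrite mcoeffD mcoeffZ mulrDr !mulrDl !mulrA [c * _]mulrC.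
Qed.

HB.instance Definition _ p :=
  GRing.isLinear.Build C FP C _ (fock_inner hb p) (fock_inner_linear p).

Lemma fock_innerDr p q q' :
  fock_inner hb p (q + q') = fock_inner hb p q + fock_inner hb p q'.
Proof. exact: linearD. Qed.

Lemma fock_innerZr c p q : fock_inner hb p (c *: q) = c * fock_inner hb p q.
Proof. exact: linearZ. Qed.

Lemma fock_inner_conj p q : (fock_inner hb p q)^* = fock_inner hb q p.
Proof.
pose b := maxn (msize p) (msize q).
rewrite !(@fock_innerwE b) ?leq_maxl ?leq_maxr // rmorph_sum.
apply: eq_bigr => K _; rewrite rmorphM [X in X * _]rmorphM /= conjCK.
by rewrite (CrealP (gtr0_real (fock_weight_gt0 K))) [_ * (q@_K)^*]mulrC.
Qed.

Lemma fock_innerDl p p' q :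
  fock_inner hb (p + p') q = fock_inner hb p q + fock_inner hb p' q.
Proof. by rewrite -fock_inner_conj linearD rmorphD /= !fock_inner_conj. Qed.

Lemma fock_innerZl c p q : fock_inner hb (c *: p) q = c^* * fock_inner hb p q.
Proof. by rewrite -fock_inner_conj linearZ rmorphM /= fock_inner_conj. Qed.

Lemma fock_inner_ge0 p : 0 <= fock_inner hb p p.
Proof.
apply: sumr_ge0 => K _; rewrite -mulrA mulr_ge0 ?[_^* * _]mulrC ?mul_conjC_ge0 //.
exact/ltW/fock_weight_gt0.
Qed.

Lemma fock_inner_eq0 p : fock_inner hb p p = 0 -> p = 0.
Proof.
rewrite (@fock_innerwE (msize p)) // => /eqP; rewrite psumr_eq0 => [/allP hp|K _].
  apply/mpolyP => K; rewrite mcoeff0.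
  case: (boolP (K \in msupp p)) => [hK|/memN_msupp_eq0 //].
  have := hp (BMultinom (msize_mdeg_lt hK)); rewrite mem_index_enum /= => /(_ isT).
  rewrite mulf_eq0 [X in X || _]mulf_eq0 conjC_eq0 orbb (gt_eqF (fock_weight_gt0 K)) orbF.
  by move/eqP.
rewrite mulr_ge0 ?[_^* * _]mulrC ?mul_conjC_ge0 //.
exact/ltW/fock_weight_gt0.
Qed.

Lemma fock_innerX K q : fock_inner hb 'X_[K] q = q@_K * fock_weight K.
Proof.
by rewrite /fock_inner msuppX big_seq1 mcoeffX eqxx conjC1 mul1r -mulrA.
Qed.

(** Creation and annihilation operators are adjoint: on monomials this is the ratio $\hbar(K_i+1)$
    of the weights of $K + e_i$ and $K$. *)
Lemma fock_inner_mulX i p q :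
  fock_inner hb ('X_i * p) q = fock_inner hb p (h *: q^`M(i)).
Proof.
elim/mpolyind: p => [|c K p _ _ IH].
  by rewrite mulr0 -fock_inner_conj linear0 conjC0 -fock_inner_conj linear0 conjC0.
rewrite mulrDr !fock_innerDl IH; congr (_ + _).
rewrite -scalerAr !fock_innerZl; congr (_ * _).
rewrite mulrC -mpolyXD !fock_innerX mcoeffZ mcoeff_mderiv /fock_weight.
rewrite mdegD mdeg1 addn1 exprS mfactD1 natrM -[_ *+ _]mulr_natr.
by ring.
Qed.

Lemma fock_inner_mderiv i p q :
  fock_inner hb (h *: p^`M(i)) q = fock_inner hb p ('X_i * q).
Proof. by rewrite -fock_inner_conj -fock_inner_mulX fock_inner_conj. Qed.

(** Since [piF] sums over the support of its symbol, linearity in the symbol requires extending the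
    sums to a common range. *)
Lemma msupp_sum_linear (V : lmodType C) (l : nat) (G : 'X_{1..l} -> V) :
  linear (fun f : {mpoly C[l]} => \sum_(m <- msupp f) f@_m *: G m).
Proof.
have wide b (f : {mpoly C[l]}) : (msize f <= b)%N ->
    \sum_(m <- msupp f) f@_m *: G m = \sum_(m : 'X_{1..l < b}) f@_m *: G m.
  move=> le_fb; pose I : subFinType _ := 'X_{1..l < b}.
  rewrite (big_mksub I) /=; first last.
    by move=> x /msize_mdeg_lt/leq_trans/(_ le_fb).
    by rewrite msupp_uniq.
  by rewrite big_rmcond //= => K /memN_msupp_eq0 ->; rewrite scale0r.
move=> c f f'; pose b := maxn (msize (c *: f + f')) (maxn (msize f) (msize f')).
rewrite !(wide b) ?leq_max ?leqnn ?orbT // scaler_sumr -big_split.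
by apply: eq_bigr => K _ /=; rewrite mcoeffD mcoeffZ scalerDl scalerA.
Qed.

Definition piF_mon p m : FP := h ^+ mdeg (anti m) *: ('X_[holo m] * p^`M[anti m]).

Lemma piFE f p : piF hb f p = \sum_(m <- msupp f) f@_m *: piF_mon p m.
Proof. by apply: eq_bigr => m _; rewrite scalerA. Qed.

Lemma piF_linear_l p : linear (fun f => piF hb f p).
Proof. by move=> c f f'; rewrite !piFE msupp_sum_linear. Qed.

Lemma piF_linear_r f : linear (piF hb f).
Proof.
move=> c p q; rewrite /piF scaler_sumr -big_split; apply: eq_bigr => m _ /=.
by rewrite linearP /= mulrDr -scalerAr scalerDr !scalerA [_ * c]mulrC.
Qed.

HB.instance Definition _ f :=
  GRing.isLinear.Build C FP FP _ (piF hb f) (piF_linear_r f).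

Lemma piFZr c f p : piF hb f (c *: p) = c *: piF hb f p.
Proof. exact: linearZ. Qed.

Lemma piFDl f g p : piF hb (f + g) p = piF hb f p + piF hb g p.
Proof. by have := piF_linear_l p 1 f g; rewrite !scale1r. Qed.

Lemma piF0l p : piF hb 0 p = 0.
Proof. by rewrite /piF msupp0 big_nil. Qed.

Lemma piFZl c f p : piF hb (c *: f) p = c *: piF hb f p.
Proof. by have := piF_linear_l p c f 0; rewrite !addr0 piF0l addr0. Qed.

Lemma piF_suml (I : Type) (r : seq I) P (F : I -> WP) p :
  piF hb (\sum_(i <- r | P i) F i) p = \sum_(i <- r | P i) piF hb (F i) p.
Proof. exact: (big_morph (fun f => piF hb f p) (fun f g => piFDl f g p) (piF0l p)). Qed.

Lemma piFX m p : piF hb 'X_[m] p = piF_mon p m.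
Proof. by rewrite piFE msuppX big_seq1 mcoeffX eqxx scale1r. Qed.

Opaque piF fock_inner.

Lemma holoDz i m : holo (m + U_(zvar i)) = (holo m + U_(i))%MM.
Proof. by apply/mnmP => j; rewrite !(mnmE, mnmDE, mnm1E) !varE. Qed.

Lemma antiDz i m : anti (m + U_(zvar i)) = anti m.
Proof. by apply/mnmP => j; rewrite !(mnmE, mnmDE, mnm1E) !varE addn0. Qed.

Lemma holoDzb i m : holo (m + U_(zbvar i)) = holo m.
Proof. by apply/mnmP => j; rewrite !(mnmE, mnmDE, mnm1E) !varE addn0. Qed.

Lemma antiDzb i m : anti (m + U_(zbvar i)) = (anti m + U_(i))%MM.
Proof. by apply/mnmP => j; rewrite !(mnmE, mnmDE, mnm1E) !varE. Qed.

Lemma holo0 : holo (0%MM : 'X_{1..n.+1 + n.+1}) = 0%MM.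
Proof. by apply/mnmP => j; rewrite !(mnmE, mnm0E). Qed.

Lemma anti0 : anti (0%MM : 'X_{1..n.+1 + n.+1}) = 0%MM.
Proof. by apply/mnmP => j; rewrite !(mnmE, mnm0E). Qed.

Lemma piF1 p : piF hb 1 p = p.
Proof.
rewrite -mpolyX0 piFX /piF_mon holo0 anti0 mdeg0 expr0 scale1r mpolyX0 mul1r.
exact: mderivm0m.
Qed.

Lemma piF_z i f p : piF hb (z i * f) p = 'X_i * piF hb f p.
Proof.
elim/mpolyind: f => [|c m f _ _ IH]; first by rewrite mulr0 piF0l mulr0.
rewrite mulrDr piFDl IH piFDl mulrDr; congr (_ + _).
rewrite -scalerAr piFZl piFZl -scalerAr; congr (_ *: _).
rewrite mulrC -mpolyXD !piFX /piF_mon holoDz antiDz -scalerAr mpolyXD.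
by rewrite mulrA ['X_i * _]mulrC.
Qed.

Lemma piF_zb i f p : piF hb (zb i * f) p = piF hb f (h *: p^`M(i)).
Proof.
elim/mpolyind: f => [|c m f _ _ IH]; first by rewrite mulr0 !piF0l.
rewrite mulrDr piFDl piFDl; refine (f_equal2 +%R _ IH).
rewrite -scalerAr piFZl piFZl; apply: (congr1 ( *:%R c)).
rewrite mulrC -mpolyXD !piFX /piF_mon holoDzb antiDzb mdegD mdeg1 addn1 exprSr.
rewrite mderivmZ -scalerAr scalerA; congr (_ *: (_ * _)).
by rewrite addmC mderivmDm mderivmU1m.
Qed.

(** The commutator of $\partial_i$ with $\pi(f)$ is $\pi(\partial_{z_i} f)$; this handles the factor
    [zb j] in the recursion for [piF_wick]. *)
Lemma mderiv_piF i f p :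
  (piF hb f p)^`M(i) = piF hb (dz i f) p + piF hb f (p^`M(i)).
Proof.
elim/wpoly_ind: f p => [c f IH|f f' IH IH'||j f IH|j f IH] p.
- by rewrite piFZl !mderivZ piFZl IH piFZl scalerDr.
- by rewrite piFDl mderivD IH IH' mderivD piFDl piFDl; exact: addrACA.
- by rewrite !piF1 -mpolyC1 mderivC piF0l add0r.
- rewrite !piF_z !mderivM IH piFDl !mderivU eq_zvar mulrDr addrA piF_z.
  by case: (_ == _); rewrite ?mul0r ?piF0l // !mul1r.
rewrite !piF_zb IH mderivM mderivU eq_zvar_zbvar mul0r add0r piF_zb mderivZ.
by rewrite mderiv_comm.
Qed.

Lemma piF_wick f g p : piF hb (f ⋆ g) p = piF hb f (piF hb g p).
Proof.
elim/wpoly_ind: f g => [c f IH|f f' IH IH'||j f IH|j f IH] g.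
- by rewrite wickZl !piFZl IH.
- by rewrite wickDl !piFDl IH IH'.
- by rewrite wick1l piF1.
- by rewrite wick_zl !piF_z IH.
rewrite wick_zbl IH piF_zb; congr piF.
by rewrite piFDl piF_zb piFZl mderiv_piF scalerDr piFZr; exact: addrC.
Qed.

Lemma piF_adj f p q :
  fock_inner hb p (piF hb f q) = fock_inner hb (piF hb (pconj f) p) q.
Proof.
elim/wpoly_ind: f p q => [c f IH|f f' IH IH'||j f IH|j f IH] p q.
- by rewrite piFZl fock_innerZr pconjZ piFZl fock_innerZl conjCK IH.
- by rewrite piFDl fock_innerDr pconjD piFDl fock_innerDl IH IH'.
- by rewrite pconj1 !piF1.
- by rewrite piF_z pconjM pconj_z piF_zb -IH fock_inner_mderiv.
by rewrite piF_zb pconjM pconj_zb piF_z IH fock_inner_mulX.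
Qed.

Lemma sos_Bplus f : inB f -> Bplus hb (pconj f ⋆ f).
Proof.
move=> hf; split; first by apply: inB_wick => //; apply: inB_pconj.
split=> [|p]; first by rewrite /wherm pconj_wick pconjK.
by rewrite piF_wick piF_adj pconjK fock_inner_ge0.
Qed.

Definition vec_state p f : C := fock_inner hb p (piF hb f p) / fock_inner hb p p.

Lemma vec_stateP p : p != 0 -> is_state hb (vec_state p).
Proof.
move=> p0; split=> [a b f g _ _||f _ hf|f [_ [_ hf]]].
- by rewrite /vec_state piFDl !piFZl fock_innerDr !fock_innerZr mulrDl !mulrA.
- rewrite /vec_state piF1 divff //; apply/eqP => /fock_inner_eq0/eqP.
  exact/negP.
- apply: rpredM; last by rewrite rpredV ger0_real // fock_inner_ge0.
  by apply/CrealP; rewrite fock_inner_conj [RHS]piF_adj hf.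
by rewrite divr_ge0 ?fock_inner_ge0.
Qed.

Definition fock_homog k p := forall K, K \in msupp p -> mdeg K = k.

(** [J] acts as $\hbar$ times the Euler operator, so the homogeneous components of the Fock space
    are its eigenspaces. *)
Lemma piF_J k p : fock_homog k p -> piF hb J p = (h * k%:R) *: p.
Proof.
move=> hp; rewrite /Jpoly piF_suml.
under eq_bigr => i _ do rewrite -[zb i]mulr1 piF_z piF_zb piF1 -scalerAr.
rewrite -scaler_sumr -scalerA; congr (_ *: _); apply/mpolyP => K.
have -> : (k%:R *: p)@_K = (mdeg K)%:R * p@_K.
  rewrite mcoeffZ.
  by case: (boolP (K \in msupp p)) => [/hp ->//|/memN_msupp_eq0 ->]; rewrite !mulr0.
rewrite raddf_sum mdegE natr_sum mulr_suml; apply: eq_bigr => i _.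
exact: mcoeff_mulX_mderiv.
Qed.

End Fock.

(** * Reality and Cauchy-Schwarz for states *)

Section States.
Variables (R : realType) (n : nat) (hb : R).
Hypothesis hhb : 0 < hb.
Local Notation C := R[i].
Local Notation WP := {mpoly C[n.+1 + n.+1]}.
Local Notation "f ⋆ g" := (wick hb f g) (at level 40, left associativity).
Implicit Types (f g : WP) (c : C).
Variable omega : WP -> C.
Hypothesis omegaP : is_state hb omega.

Lemma stateD f g : inB f -> inB g -> omega (f + g) = omega f + omega g.
Proof.
by case: omegaP => lin _ _ _ hf hg; have := lin 1 1 f g hf hg; rewrite !scale1r !mul1r.
Qed.

Lemma stateZ c f : inB f -> omega (c *: f) = c * omega f.
Proof.
case: omegaP => lin _ _ _ hf; have := lin c 0 f f hf hf.
by rewrite scale0r addr0 mul0r addr0.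
Qed.

Lemma stateN f : inB f -> omega (- f) = - omega f.
Proof. by move=> hf; rewrite -(scaleN1r f) stateZ // mulN1r. Qed.

Lemma state0 : omega 0 = 0.
Proof. by rewrite -(scale0r (1 : WP)) stateZ ?mul0r //; apply: inB1. Qed.

Lemma state_pconj f : inB f -> omega (pconj f) = (omega f)^*.
Proof.
move=> hf; have hf' := inB_pconj hf; have [_ _ re _] := omegaP.
have r1 : omega f + omega (pconj f) \is Num.real.
  rewrite -stateD //; apply: re; first exact: inBD.
  by rewrite /wherm pconjD pconjK addrC.
have r2 : 'i * (omega f - omega (pconj f)) \is Num.real.
  rewrite -stateN // -stateD -?stateZ; [|exact/inBD/inBN|by []|exact: inBN].
  apply: re; first exact/inBZ/inBD/inBN.
  by rewrite /wherm pconjZ pconjD pconjN pconjK conjCi scaleNr -scalerN opprD opprK addrC.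
move/CrealP: r1; rewrite rmorphD => e1.
move/CrealP: r2; rewrite rmorphM rmorphB /= conjCi mulNr -mulrN => /(mulfI (neq0Ci _)).
rewrite opprB => e2.
have : (omega f)^* *+ 2 = omega (pconj f) *+ 2.
  have -> : (omega f)^* *+ 2 = ((omega f)^* + (omega (pconj f))^*)
    - ((omega (pconj f))^* - (omega f)^*) by ring.
  by rewrite e1 e2; ring.
by move/eqP; rewrite eqr_pMn2r // => /eqP.
Qed.

(* Cauchy-Schwarz for the form (f, g) |-> omega (f^* g), with f = x of length zero. *)
Lemma state_null_wick x q : inB x -> wherm x -> inB q ->
  omega (x ⋆ x) = 0 -> omega (x ⋆ q) = 0.
Proof.
move=> hx hxh hq hxx; have [_ _ re pos] := omegaP.
have hxq : inB (x ⋆ q) by apply: inB_wick.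
have hqx : inB (pconj q ⋆ x) by apply: inB_wick => //; apply: inB_pconj.
have hqq : inB (pconj q ⋆ q) by apply: inB_wick => //; apply: inB_pconj.
have hxx' : inB (x ⋆ x) by apply: inB_wick.
pose a := omega (x ⋆ q); pose d := omega (pconj q ⋆ q).
have d_ge0 : 0 <= d by apply/pos/sos_Bplus.
(* Positivity on the square of [t *: x + q]; the term quadratic in [t] drops out by [hxx]. *)
have main t : 0 <= t^* * a + t * a^* + d.
  have hp : inB (t *: x + q) by apply: inBD => //; apply: inBZ.
  have := pos _ (sos_Bplus hhb hp).
  rewrite pconjD pconjZ hxh wickDl !wickDr !wickZl !wickZr !scalerA.
  have i1 := inBZ (c := t^* * t) hxx'; have i2 := inBZ (c := t^*) hxq.
  have i3 := inBZ (c := t) hqx.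
  have ac : omega (pconj q ⋆ x) = a^* by rewrite -state_pconj // pconj_wick hxh.
  suff -> : omega ((t^* * t) *: (x ⋆ x) + t^* *: (x ⋆ q)
      + (t *: (pconj q ⋆ x) + pconj q ⋆ q)) = t^* * a + (t * a^* + d).
    by rewrite addrA.
  apply: etrans (stateD (inBD i1 i2) (inBD i3 hqq)) _; apply: f_equal2.
    apply: etrans (stateD i1 i2) _; rewrite -[RHS]add0r; apply: f_equal2.
      by apply: etrans (stateZ _ hxx') _; rewrite hxx mulr0.
    exact: stateZ.
  apply: etrans (stateD i3 hqq) _; apply: f_equal2; last by [].
  by rewrite -ac; apply: stateZ.
have [a_eq0|a0] := eqVneq a 0; first exact: a_eq0.
have aa : 0 < a * a^* by rewrite mul_conjC_gt0.
(* The factor [s] is chosen so that [t = - (s * a)] makes the expression in [main] equal to $-(d+1)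
   + d = -1$. *)
have [s sr sE] : exists2 s, s^* = s & s * (a * a^*) = (d + 1) / 2.
  exists ((d + 1) / (a * a^* *+ 2)).
    apply/CrealP/rpredM; first by rewrite rpredD ?rpred1 // ger0_real.
    by rewrite rpredV rpredMn // gtr0_real.
  move: (a * a^*) aa => w w_gt0.
  by rewrite -mulr_natl invfM mulrA mulfVK // gt_eqF.
have sc : (- (s * a))^* = - (s * a^*) by rewrite rmorphN rmorphM /= sr.
have := main (- (s * a)); rewrite sc !mulNr -!mulrA [a^* * a]mulrC sE.
have -> : - ((d + 1) / 2) - (d + 1) / 2 + d = -1.
  by rewrite -opprD -splitr opprD addrAC addNr add0r.
by rewrite oppr_ge0 ler10.
Qed.

End States.

(** * Quadratic modules in *-algebras *)

(** Summing over the phases $1$ and $i$ isolates the antilinear term: the [u] terms add up and the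
    [v] terms cancel. *)
Lemma polarize_pair (C : numClosedFieldType) (V : lmodType C) (u v : V) :
  ((1 : C)^* *: u + (1 : C) *: v) + ('i : C) *: (('i : C)^* *: u + ('i : C) *: v)
  = (2 : C) *: u.
Proof.
rewrite conjC1 conjCi !scale1r scalerDr !scalerA mulrN -expr2 sqrCi opprK.
by rewrite scale1r scaleN1r addrACA subrr addr0 scaler_nat mulr2n.
Qed.

Section QuadraticModule.
Variables (C : numClosedFieldType) (A : lmodType C).
Variables (mul : A -> A -> A) (one : A) (st : A -> A) (B : A -> Prop) (x : A).
Local Infix "⋆" := mul (at level 40, left associativity).
Implicit Types (a b f g q : A) (c : C).

(** The algebraic rules used by the theory of quadratic modules below. Here [B] is a predicate on a
    larger algebra, because factors outside [B] occur later; [x] is Hermitian and commutes with the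
    elements of [B]. *)
Record star_axioms : Prop := StarAxioms {
  sa_Dl : forall f g a, (f + g) ⋆ a = f ⋆ a + g ⋆ a;
  sa_Dr : forall f g a, a ⋆ (f + g) = a ⋆ f + a ⋆ g;
  sa_Zl : forall c f a, (c *: f) ⋆ a = c *: (f ⋆ a);
  sa_Zr : forall c f a, a ⋆ (c *: f) = c *: (a ⋆ f);
  sa_A : forall f g a, f ⋆ (g ⋆ a) = f ⋆ g ⋆ a;
  sa_1l : forall f, one ⋆ f = f;
  sa_1r : forall f, f ⋆ one = f;
  sa_stD : forall f g, st (f + g) = st f + st g;
  sa_stZ : forall c f, st (c *: f) = c^* *: st f;
  sa_stM : forall f g, st (f ⋆ g) = st g ⋆ st f;
  sa_stK : forall f, st (st f) = f;
  sa_BD : forall f g, B f -> B g -> B (f + g);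
  sa_BZ : forall c f, B f -> B (c *: f);
  sa_BM : forall f g, B f -> B g -> B (f ⋆ g);
  sa_Bst : forall f, B f -> B (st f);
  sa_B1 : B one;
  sa_Bx : B x;
  sa_stx : st x = x;
  sa_xC : forall f, B f -> x ⋆ f = f ⋆ x }.

Hypothesis S : star_axioms.

Lemma conjC_half : (2^-1 : C)^* = 2^-1.
Proof. by rewrite fmorphV rmorph_nat. Qed.

Lemma st_one : st one = one.
Proof. by have := sa_stM S one (st one); rewrite (sa_1l S) (sa_stK S) (sa_1l S). Qed.

Lemma st_opp f : st (- f) = - st f.
Proof. by rewrite -scaleN1r (sa_stZ S) rmorphN1 scaleN1r. Qed.

Lemma st_zero : st 0 = 0.
Proof. by have := sa_stZ S 0 0; rewrite conjC0 !scale0r. Qed.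

Lemma star0r a : a ⋆ 0 = 0.
Proof. by have := sa_Zr S 0 0 a; rewrite !scale0r. Qed.

Lemma star0l a : 0 ⋆ a = 0.
Proof. by have := sa_Zl S 0 0 a; rewrite !scale0r. Qed.

Lemma star_Nl f a : (- f) ⋆ a = - (f ⋆ a).
Proof. by rewrite -scaleN1r (sa_Zl S) scaleN1r. Qed.

Lemma star_Nr f a : a ⋆ (- f) = - (a ⋆ f).
Proof. by rewrite -scaleN1r (sa_Zr S) scaleN1r. Qed.

Lemma star_sumr (I : Type) (r : seq I) (F : I -> A) a :
  a ⋆ (\sum_(i <- r) F i) = \sum_(i <- r) a ⋆ F i.
Proof. exact: (big_morph (mul a) (fun f g => sa_Dr S f g a) (star0r a)). Qed.

Lemma star_suml (I : Type) (r : seq I) (F : I -> A) a :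
  (\sum_(i <- r) F i) ⋆ a = \sum_(i <- r) F i ⋆ a.
Proof. exact: (big_morph (mul^~ a) (fun f g => sa_Dl S f g a) (star0l a)). Qed.

Lemma subB_opp f : B f -> B (- f).
Proof. by rewrite -scaleN1r; apply: (sa_BZ S). Qed.

Lemma subB0 : B 0.
Proof. by rewrite -(scale0r one); apply/(sa_BZ S)/(sa_B1 S). Qed.

Lemma subB_sum (s : seq A) (F : A -> A) : (forall a, a \in s -> B (F a)) ->
  B (\sum_(a <- s) F a).
Proof.
move=> hF; rewrite big_seq; apply: big_ind => //; first exact: subB0.
exact: (sa_BD S).
Qed.

(* The reality condition on [x ⋆ q] encodes that only Hermitian elements of the ideal
   are added to the sums of squares. *)
Definition qmod f := exists (s : seq A) q,
  [/\ forall a, a \in s -> B a, B q, st (x ⋆ q) = x ⋆ q &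
      f = \sum_(a <- s) st a ⋆ a + x ⋆ q].

Lemma qmod_subB f : qmod f -> B f.
Proof.
case=> s [q [hs hq _ ->]]; apply: (sa_BD S); last exact/(sa_BM S)/hq/(sa_Bx S).
by apply: subB_sum => a /hs ha; apply: (sa_BM S) => //; apply: (sa_Bst S).
Qed.

Lemma qmod_herm f : qmod f -> st f = f.
Proof.
case=> s [q [hs hq hst ->]]; rewrite (sa_stD S) hst; congr (_ + _).
rewrite (big_morph st (sa_stD S) st_zero); apply: eq_bigr => a _.
by rewrite (sa_stM S) (sa_stK S).
Qed.

Lemma qmodD f g : qmod f -> qmod g -> qmod (f + g).
Proof.
case=> s [q [hs hq hst ->]] [s' [q' [hs' hq' hst' ->]]].
exists (s ++ s'), (q + q'); split; last by rewrite big_cat (sa_Dr S) addrACA.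
- by move=> a; rewrite mem_cat => /orP[/hs|/hs'].
- exact: (sa_BD S).
by rewrite (sa_Dr S) (sa_stD S) hst hst'.
Qed.

Lemma qmod_ideal q : B q -> st (x ⋆ q) = x ⋆ q -> qmod (x ⋆ q).
Proof. by move=> hq hst; exists [::], q; rewrite big_nil add0r. Qed.

Lemma qmod_sos a : B a -> qmod (st a ⋆ a).
Proof.
move=> ha; exists [:: a], 0; rewrite big_seq1 star0r addr0 st_zero.
by split=> // [b|]; [rewrite inE => /eqP ->|apply: subB0].
Qed.

Lemma qmod0 : qmod 0.
Proof. by have := qmod_sos subB0; rewrite star0r. Qed.

Lemma qmodZ c f : 0 <= c -> qmod f -> qmod (c *: f).
Proof.
move=> c0 [s [q [hs hq hst ->]]].
have cc : (sqrtC c)^* * sqrtC c = c by rewrite -normCKC ger0_norm ?sqrtC_ge0 // sqrtCK.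
exists [seq sqrtC c *: a | a <- s], (c *: q); split.
- by move=> b /mapP[a /hs ha ->]; apply: (sa_BZ S).
- exact: (sa_BZ S).
- by rewrite (sa_Zr S) (sa_stZ S) hst (CrealP (ger0_real c0)).
rewrite big_map scalerDr (sa_Zr S) scaler_sumr; congr (_ + _).
by apply: eq_bigr => a _; rewrite (sa_stZ S) (sa_Zl S) (sa_Zr S) scalerA cc.
Qed.

Lemma qmod_conj b f : B b -> qmod f -> qmod (st b ⋆ f ⋆ b).
Proof.
move=> hb [s [q [hs hq hst ->]]]; have hb' := sa_Bst S hb.
have xq : st b ⋆ (x ⋆ q) ⋆ b = x ⋆ (st b ⋆ q ⋆ b).
  by rewrite !(sa_A S) (sa_xC S).
exists [seq a ⋆ b | a <- s], (st b ⋆ q ⋆ b); split.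
- by move=> a' /mapP[a /hs ha ->]; apply: (sa_BM S).
- by do 2?[apply: (sa_BM S)].
- by rewrite -xq !(sa_stM S) (sa_stK S) -(sa_stM S) hst (sa_A S).
rewrite -xq (sa_Dr S) (sa_Dl S) star_sumr star_suml big_map; congr (_ + _).
by apply: eq_bigr => a _; rewrite (sa_stM S) !(sa_A S).
Qed.

(** The ideal part [x ⋆ q] is Hermitian automatically, as the difference of the Hermitian elements
    [g] and [f]. *)
Lemma qmod_modx f g q : qmod f -> st g = g -> B q -> g = f + x ⋆ q -> qmod g.
Proof.
move=> hf hg hq e; rewrite e; apply: qmodD => //; apply: qmod_ideal => //.
have -> : x ⋆ q = g - f by rewrite e addrC addKr.
by rewrite (sa_stD S) st_opp hg qmod_herm.
Qed.

(* The complexification of [qmod] intersected with its negative, which turns out to be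
   a right ideal (hence an ideal, being closed under [st]). *)
Definition qnull f := B f /\ forall c, qmod (c *: f + st (c *: f)).

Lemma qnullD f g : qnull f -> qnull g -> qnull (f + g).
Proof.
case=> hf nf [hg ng]; split=> [|c]; first exact: (sa_BD S).
by rewrite scalerDr (sa_stD S) addrACA; apply: qmodD.
Qed.

Lemma qnullZ c f : qnull f -> qnull (c *: f).
Proof.
by case=> hf nf; split=> [|c']; [apply: (sa_BZ S)|rewrite scalerA].
Qed.

Lemma qnullN f : qnull f -> qnull (- f).
Proof. by rewrite -scaleN1r; apply: qnullZ. Qed.

Lemma qnullB f g : qnull f -> qnull g -> qnull (f - g).
Proof. by move=> hf hg; apply/qnullD/qnullN. Qed.

Lemma qnull_st f : qnull f -> qnull (st f).
Proof.
case=> hf nf; split=> [|c]; first exact: (sa_Bst S).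
by have := nf c^*; rewrite !(sa_stZ S) conjCK (sa_stK S) addrC.
Qed.

(** For Hermitian [f] the element to be tested is $(c + \bar c) f$, a real multiple of [f] of either
    sign. *)
Lemma qnull_herm f : qmod f -> qmod (- f) -> qnull f.
Proof.
move=> pf nf; have hst := qmod_herm pf.
split=> [|c]; first exact: qmod_subB.
rewrite (sa_stZ S) hst -scalerDl.
have cr : c + c^* \is Num.real by apply/CrealP; rewrite rmorphD /= conjCK addrC.
have [c0|c0] := real_leP (real0 C) cr; first exact: qmodZ.
by rewrite -[_ *: f]opprK -scaleNr -scalerN; apply: qmodZ => //; rewrite oppr_ge0 ltW.
Qed.

Lemma qnull_qmod f : st f = f -> qnull f -> qmod f.
Proof.
move=> hf [_ /(_ 2^-1)]; rewrite (sa_stZ S) hf conjC_half -scalerDl.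
by rewrite -mulr2n -[2^-1 *+ 2]mulr_natr mulVf ?scale1r ?pnatr_eq0.
Qed.

Lemma qnull_qmodN f : st f = f -> qnull f -> qmod (- f).
Proof. by move=> hf nf; apply: qnull_qmod; rewrite ?st_opp ?hf //; apply: qnullN. Qed.

Lemma qnull0 : qnull 0.
Proof. by apply: qnull_herm; rewrite ?oppr0; apply: qmod0. Qed.

Lemma qnull_sum (I : eqType) (r : seq I) (F : I -> A) :
  (forall i, i \in r -> qnull (F i)) -> qnull (\sum_(i <- r) F i).
Proof.
move=> hF; rewrite big_seq; apply: big_ind => //; first exact: qnull0.
exact: qnullD.
Qed.

Lemma qnull_ideal q : B q -> qnull (x ⋆ q).
Proof.
move=> hq; split=> [|c]; first exact/(sa_BM S)/hq/(sa_Bx S).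
have e : c *: (x ⋆ q) + st (c *: (x ⋆ q)) = x ⋆ (c *: q + c^* *: st q).
  by rewrite (sa_stZ S) (sa_stM S) (sa_stx S) -(sa_xC S) ?(sa_Dr S) ?(sa_Zr S) //;
     apply: (sa_Bst S).
have hq' : B (c *: q + c^* *: st q).
  by apply: (sa_BD S); apply: (sa_BZ S) => //; apply: (sa_Bst S).
rewrite e; apply: qmod_ideal => //.
by rewrite -e (sa_stD S) (sa_stK S) addrC.
Qed.

(* Polarization: [2 (g a + a^* g) = (1 + a)^* g (1 + a) - (1 - a)^* g (1 - a)]. *)
Lemma qmod_polar g a : qmod g -> qmod (- g) -> B a ->
  qmod (g ⋆ a + st a ⋆ g).
Proof.
move=> pg ng ha.
have expand b : st (one + b) ⋆ g ⋆ (one + b)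
    = (g + st b ⋆ g ⋆ b) + (g ⋆ b + st b ⋆ g).
  rewrite (sa_stD S) st_one !(sa_Dl S) !(sa_Dr S) !(sa_1l S) !(sa_1r S).
  by rewrite [st b ⋆ g + _]addrC addrACA.
have -> : g ⋆ a + st a ⋆ g = 2^-1 *: (st (one + a) ⋆ g ⋆ (one + a)
    + st (one - a) ⋆ (- g) ⋆ (one - a)).
  rewrite star_Nr star_Nl !expand !(st_opp, star_Nl, star_Nr) !opprK.
  rewrite -opprD [- (_ - _)]opprD opprK addrACA subrr add0r -mulr2n -scaler_nat.
  by rewrite scalerA mulVf ?pnatr_eq0 // scale1r.
apply: qmodZ; first by rewrite invr_ge0 ler0n.
by apply: qmodD; apply: qmod_conj => //; apply: (sa_BD S) => //;
   [exact: (sa_B1 S)|exact: (sa_B1 S)|exact: subB_opp].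
Qed.

Lemma qnull_starr f a : qnull f -> B a -> qnull (f ⋆ a).
Proof.
case=> hf nf ha; split=> [|c]; first exact: (sa_BM S).
pose f1 := 2^-1 *: (f + st f); pose f2 := (2^-1 * - 'i) *: (f - st f).
have nf0 : qnull f by [].
have st1 : st f1 = f1.
  by rewrite (sa_stZ S) (sa_stD S) (sa_stK S) conjC_half addrC.
have st2 : st f2 = f2.
  rewrite {1}/f2 (sa_stZ S) (sa_stD S) st_opp (sa_stK S) rmorphM rmorphN /= conjCi conjC_half.
  by rewrite opprK /f2 mulrN scaleNr -scalerN opprB.
have n1 : qnull f1 by apply/qnullZ/qnullD/qnull_st.
have n2 : qnull f2 by apply/qnullZ/qnullB/qnull_st.
have fE : f = f1 + 'i *: f2.
  rewrite /f1 /f2 scalerA mulrCA mulrN -expr2 sqrCi opprK mulr1 -scalerDr.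
  rewrite addrACA subrr addr0 -mulr2n -scaler_nat scalerA mulVf ?pnatr_eq0 //.
  by rewrite scale1r.
clearbody f1 f2.
(* With [f] split into its Hermitian parts [f1] and [f2], both null, the expression becomes two
   instances of [qmod_polar]. *)
have -> : c *: (f ⋆ a) + st (c *: (f ⋆ a)) =
    (f1 ⋆ (c *: a) + st (c *: a) ⋆ f1)
    + (f2 ⋆ (('i * c) *: a) + st (('i * c) *: a) ⋆ f2).
  rewrite {1 2}fE !(sa_stZ S) !(sa_stM S) !(sa_stD S) st1 (sa_stZ S) st2.
  rewrite !(sa_Dl S) !(sa_Dr S) !(sa_Zl S) !(sa_Zr S) !scalerDr !scalerA.
  by rewrite rmorphM /= [c * 'i]mulrC [c^* * _]mulrC addrACA.
by apply: qmodD; apply: qmod_polar;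
  solve [exact: qnull_qmod | exact: qnull_qmodN | exact: (sa_BZ S)].
Qed.

(** Polarization with [one], which lies in the module with both signs, and with [a] equal to half of
    [f]. *)
Lemma qmod_neg1_all f : qmod (- one) -> B f -> st f = f -> qmod f.
Proof.
move=> n1 hf st_f.
have p1 : qmod one by have := qmod_sos (sa_B1 S); rewrite st_one (sa_1l S).
have := qmod_polar p1 n1 (sa_BZ S 2^-1 hf).
rewrite (sa_1l S) (sa_1r S) (sa_stZ S) st_f conjC_half -scalerDl.
by rewrite -mulr2n -[2^-1 *+ 2]mulr_natr mulVf ?scale1r ?pnatr_eq0.
Qed.

End QuadraticModule.

(** * Positive semidefinite matrices as sums of rank-one matrices *)

Section PositiveSemidefinite.
Local Open Scope sesquilinear_scope.

(** By the spectral theorem $A = P^* D P$ with [P] unitary; the vector [w l] is the conjugate of row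
    [l] of [P], scaled by the square root of the eigenvalue. *)
Lemma psd_decomposition (C : numClosedFieldType) (T : finType) (c : T -> T -> C) :
  (forall s t, (c s t)^* = c t s) ->
  (forall v : T -> C, 0 <= \sum_s \sum_t (v s)^* * v t * c s t) ->
  exists w : 'I_#|T| -> T -> C, forall s t, c s t = \sum_l w l s * (w l t)^*.
Proof.
move=> herm pos; pose A := \matrix_(i < #|T|, j < #|T|) c (enum_val i) (enum_val j).
have hA : A \is hermsymmx.
  by apply/is_hermitianmxP; rewrite expr0 scale1r; apply/matrixP => i j; rewrite !mxE herm.
have /orthomx_spectralP := hermitian_normalmx hA.
set P := spectralmx A; set D := spectral_diag A => eA.
have uP : P \is unitarymx by apply: spectral_unitarymx.
rewrite (invmx_unitary uP) in eA.
(* The eigenvalue is the value of the form at the conjugate of row [l] of [P]. *)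
have D_ge0 l : 0 <= D 0 l.
  have : (P *m A *m P^t*) l l = D 0 l.
    rewrite eA !mulmxA (unitarymxP uP) mul1mx -mulmxA (unitarymxP uP) mulmx1.
    by rewrite mxE eqxx mulr1n.
  move=> <-; have := pos (fun s => (P l (enum_rank s))^*).
  have sumE (F : T -> C) : \sum_s F s = \sum_(i < #|T|) F (enum_val i).
    by rewrite (reindex (@enum_val T predT)) //; apply/onW_bij/enum_val_bij.
  rewrite sumE mxE; under eq_bigr => i _ do rewrite sumE.
  rewrite exchange_big /=; congr (0 <= _); apply: eq_bigr => j _.
  rewrite !mxE mulr_suml; apply: eq_bigr => i _; rewrite !mxE !enum_valK conjCK.
  by rewrite mulrAC.
exists (fun l s => sqrtC (D 0 l) * (P l (enum_rank s))^*) => s t.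
have -> : c s t = A (enum_rank s) (enum_rank t) by rewrite mxE !enum_rankK.
rewrite eA mxE; apply: eq_bigr => l _.
rewrite mul_mx_diag !mxE rmorphM /= conjCK mulrACA -normCK.
by rewrite ger0_norm ?sqrtC_ge0 // sqrtCK mulrAC mulrC mulrA.
Qed.

End PositiveSemidefinite.

(** * The quadratic module of the reduction *)

Section Reduction.
Variables (R : realType) (n : nat) (hb mu : R).
Hypotheses (hn : (0 < n)%N) (hhb : 0 < hb).
Local Notation C := R[i].
Local Notation WP := {mpoly C[n.+1 + n.+1]}.
Local Notation h := (hb%:C)%C.
Local Notation muC := (mu%:C)%C.
Local Notation z i := ('X_(zvar i) : WP).
Local Notation zb i := ('X_(zbvar i) : WP).
Local Notation dz i := (mderiv (zvar i)).
Local Notation "f ⋆ g" := (wick hb f g) (at level 40, left associativity).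
Local Notation J := (Jpoly R n).
Local Notation x := (Jpoly R n - muC%:MP).
Local Notation QM := (@qmod C WP (wick hb) (@pconj R n) (@inB R n) x).
Implicit Types (f g : WP) (K L : 'X_{1..n.+1}) (i j : 'I_n.+1) (c : C)
  (m : 'X_{1..n.+1 + n.+1}).

Lemma mpolyC_scale c : c%:MP = c *: (1 : WP).
Proof. by rewrite -mul_mpolyC mulr1. Qed.

Lemma conj_mu : muC^* = muC.
Proof. by apply/CrealP; rewrite complex_real. Qed.

Lemma inBx : inB x.
Proof. by rewrite mpolyC_scale; apply/inBB/inBZ/inB1/inBJ. Qed.

Lemma pconjx : pconj x = x.
Proof. by rewrite mpolyC_scale pconjB pconjJ pconjZ conj_mu pconj1. Qed.

Lemma wick_xl f : x ⋆ f = J ⋆ f - muC *: f.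
Proof. by rewrite mpolyC_scale wickBl wickZl wick1l. Qed.

Lemma wick_xr f : f ⋆ x = f ⋆ J - muC *: f.
Proof. by rewrite mpolyC_scale wickBr wickZr wick1r. Qed.

Lemma wick_axioms : star_axioms (wick hb) (1 : WP) (@pconj R n) (@inB R n) x.
Proof.
split.
- by move=> f g a; exact: wickDl.
- by move=> f g a; exact: wickDr.
- by move=> c f a; exact: wickZl.
- by move=> c f a; exact: wickZr.
- by move=> f g a; exact: wickA.
- exact: wick1l.
- exact: wick1r.
- exact: pconjD.
- exact: pconjZ.
- exact: pconj_wick.
- exact: pconjK.
- by move=> f g; exact: inBD.
- by move=> c f; exact: inBZ.
- by move=> f g; exact: inB_wick.
- by move=> f; exact: inB_pconj.
- exact: inB1.
- exact: inBx.
- exact: pconjx.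
by move=> f /(inB_commJ hhb) hf; rewrite wick_xl wick_xr hf.
Qed.
Local Notation S := wick_axioms.

Lemma qmod_state_ge0 omega f : is_state hb omega -> omega (x ⋆ x) = 0 ->
  QM f -> 0 <= omega f.
Proof.
move=> hom hx [s [q [hs hq hst ->]]].
have hsum : inB (\sum_(a <- s) pconj a ⋆ a).
  by apply: inB_sum => a /hs ha; apply: inB_wick => //; apply: inB_pconj.
have hxq : inB (x ⋆ q) by apply: inB_wick => //; apply: inBx.
rewrite (stateD hom hsum hxq).
rewrite (state_null_wick hhb hom inBx pconjx hq hx) addr0.
elim: s hs {hsum} => [|a s IH] hs; first by rewrite big_nil (state0 hom).
have ha : inB a by apply: hs; rewrite mem_head.
have hs' b : b \in s -> inB b by move=> hb'; apply: hs; rewrite inE hb' orbT.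
rewrite big_cons (stateD hom).
- rewrite addr_ge0 ?IH //; have [_ _ _ pos] := hom.
  exact/pos/sos_Bplus.
- by apply: inB_wick => //; apply: inB_pconj.
by apply: inB_sum => b /hs' hb'; apply: inB_wick => //; apply: inB_pconj.
Qed.

(** The commutators of [J] with [g] and with [pconj g] have opposite weights and cancel, although
    [g] itself may lie outside [B]. *)
Lemma inB_pconj_wick a b g : bihom a b g -> inB (pconj g ⋆ g).
Proof.
move=> hg; apply/(inB_commJ hhb); rewrite wickA.
rewrite (wick_J_comm_bihom hb (bihom_pconj hg)) wickDl wickZl -wickA.
rewrite (wick_J_comm_bihom hb hg) wickDr wickZr wickA -addrA -scalerDl.
by rewrite -mulrDr addrA subrK subrr mulr0 scale0r addr0.
Qed.

(** The sum of the [zb i ⋆ z i] is $J + \hbar(n+1)$, which stands between [pconj g] and [g]. Moving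
    [J] to the right of [g] costs $\hbar(a-b)$, and there it equals $\mu$ modulo [x]. *)
Lemma sum_z_wick a b g : bihom a b g ->
  \sum_i pconj (z i * g) ⋆ (z i * g)
  = (muC + h * (n.+1%:R + a%:R - b%:R)) *: (pconj g ⋆ g) + x ⋆ (pconj g ⋆ g).
Proof.
move=> hg; have hgg := inB_pconj_wick hg.
rewrite (sa_xC S hgg) wick_xr -wickA.
have -> : g ⋆ J = J ⋆ g - (h * (a%:R - b%:R)) *: g.
  by rewrite (wick_J_comm_bihom hb hg) addrK.
have -> : \sum_i pconj (z i * g) ⋆ (z i * g)
    = pconj g ⋆ (J ⋆ g + (h * n.+1%:R) *: g).
  have -> : J ⋆ g + (h * n.+1%:R) *: g = \sum_i (zb i * (z i * g) + h *: dz i (z i * g)).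
    have -> : (h * n.+1%:R) *: g = \sum_(i < n.+1) h *: g.
      by rewrite sumr_const card_ord -[RHS]scaler_nat scalerA [_ * h]mulrC.
    rewrite wick_Jl /Jpoly mulr_suml scaler_sumr -!big_split /=.
    apply: eq_bigr => i _.
    rewrite mderivM mderivU eqxx mul1r scalerDr mulrA [zb i * _]mulrC -addrA.
    by rewrite [h *: g + _]addrC.
  by rewrite wick_sumr; apply: eq_bigr => i _; rewrite pconjM pconj_z wick_zbl.
rewrite wickBr wickDr !wickZr; set u := pconj g ⋆ (J ⋆ g); set v := pconj g ⋆ g.
rewrite [RHS]addrC -!addrA; apply: f_equal2; first by [].
rewrite -[- (_ *: v)]scaleNr -[- (muC *: v)]scaleNr -!scalerDl; apply: (congr1 ( *:%R^~ v)); ring.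
Qed.

(* Descending induction on [a]: for [a = b] this is a square in B, and [sum_z_wick]
   expresses the case [a] through the case [a + 1] with a positive factor. This is how
   [p * pconj p], with a factor p outside B, is seen to lie in the quadratic module. *)
Lemma qmod_pconj_wick a b g : (a <= b)%N -> 0 < muC + h * (n.+1%:R - b%:R) ->
  bihom a b g -> QM (pconj g ⋆ g).
Proof.
move=> le_ab pos; move: {2}(b - a)%N (erefl (b - a)%N) => d.
elim: d a g le_ab => [|d IH] a g le_ab ed hg.
  have e : a = b by apply/eqP; rewrite eqn_leq le_ab -subn_eq0 ed.
  by apply: (qmod_sos S); apply: (@inB_bihom _ _ b); rewrite -{1}e.
have lt_ab : (a < b)%N by rewrite -subn_gt0 ed.
set c := muC + h * (n.+1%:R + a%:R - b%:R).
(* The coefficient increases with [a], and [pos] is its value at [a = 0]. *)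
have c_gt0 : 0 < c.
  rewrite /c addrAC mulrDr addrA; apply: ltr_wpDr => //.
  by rewrite mulr_ge0 ?ler0n // ltW // h_gt0.
have qs : QM (\sum_i pconj (z i * g) ⋆ (z i * g)).
  apply: big_ind => [||i _]; first exact: (qmod0 S).
    exact: (qmodD S).
  by apply: (IH a.+1) => //; [rewrite subnS ed | apply: bihom_z].
have hgg := inB_pconj_wick hg.
apply: (qmod_modx S (q := - c^-1 *: (pconj g ⋆ g)) (qmodZ S (c := c^-1) _ qs)).
- by rewrite invr_ge0 ltW.
- by rewrite pconj_wick pconjK.
- exact: inBZ.
rewrite (sum_z_wick hg) -/c scalerDr scalerA mulVf ?gt_eqF // scale1r.
by rewrite wickZr scaleNr addrK.
Qed.

Lemma wick_zmon K g : 'X_[zmon K] ⋆ g = 'X_[zmon K] * g.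
Proof.
elim/multinom_ind: K => [|i K IH].
  have -> : zmon (0%MM : 'X_{1..n.+1}) = 0%MM.
    by apply/eqP; rewrite -mdeg_eq0 mdeg_zmon mdeg0.
  by rewrite mpolyX0 wick1l mul1r.
by rewrite zmonD1 mpolyXD mulrC wick_zl IH mulrA.
Qed.

Lemma holo_antiK m : m = (zmon (holo m) + zbmon (anti m))%MM.
Proof. by apply/mnmP; elim/var_ind => i; rewrite !varE !mnmE ?addn0. Qed.

Lemma wick_holo a f g : bihom a 0 f -> f ⋆ g = f * g.
Proof.
move=> hf; rewrite [f]mpolyE wick_suml mulr_suml big_seq [RHS]big_seq.
apply: eq_bigr => m /hf[_ /eqP]; rewrite mdeg_eq0 => /eqP ha.
rewrite wickZl -scalerAl (holo_antiK m) ha.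
have -> : zbmon (0%MM : 'X_{1..n.+1}) = 0%MM.
  by apply/eqP; rewrite -mdeg_eq0 mdeg_zbmon mdeg0.
by rewrite addm0 wick_zmon.
Qed.

(** A holomorphic left factor is not differentiated, so the pointwise product is the Wick square of
    [pconj f], of bidegree [(0, d)]. *)
Lemma qmod_mul_pconj d f : 0 < muC + h * (n.+1%:R - d%:R) -> bihom d 0 f ->
  QM (f * pconj f).
Proof.
move=> pos hf; rewrite -(wick_holo _ hf) -{1}[f]pconjK.
by apply: (@qmod_pconj_wick 0 d) => //; apply: bihom_pconj.
Qed.

(** Pointwise and Wick multiplication by [J] differ by $\hbar d$ in this bidegree, and the Wick
    factor [J] is $\mu$ modulo [x]. *)
Lemma mulJ d f : bihom d d f -> J * f = (muC - h * d%:R) *: f + x ⋆ f.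
Proof.
move=> hf; rewrite wick_xl (wick_Jl_bihom hb hf) scalerBl.
by rewrite [RHS]addrC subrKA addrK.
Qed.

Lemma mulJ_pconj f : J * (f * pconj f) = \sum_i (z i * f) * pconj (z i * f).
Proof.
rewrite /Jpoly mulr_suml; apply: eq_bigr => i _.
by rewrite pconjM pconj_z mulrACA.
Qed.

(** Each factor [J] is absorbed as a sum over the $z_i$, leaving products [p * pconj p] with [p]
    holomorphic of degree [d + e]. *)
Lemma qmod_mulJn e d f : 0 < muC + h * (n.+1%:R - (d + e)%:R) -> bihom d 0 f ->
  QM (J ^+ e * (f * pconj f)).
Proof.
elim: e d f => [|e IH] d f pos hf.
  by rewrite expr0 mul1r; apply: qmod_mul_pconj hf; rewrite addn0 in pos.
rewrite exprSr -mulrA mulJ_pconj mulr_sumr.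
apply: big_ind => [||i _]; [exact: (qmod0 S)|exact: (qmodD S)|].
by apply: (IH d.+1); [rewrite addSnnS|apply: bihom_z].
Qed.

Lemma bihom_Jn e : bihom e e (J ^+ e).
Proof.
by elim: e => [|e IH]; [rewrite expr0; apply: bihom1|rewrite exprS; apply: bihomJ].
Qed.

Lemma Jn_modx e : exists2 q, inB q &
  J ^+ e = (\prod_(d < e) (muC - h * d%:R)) *: 1 + x ⋆ q.
Proof.
elim: e => [|e [q hq eq]].
  by exists 0; [exact: inB0|rewrite expr0 big_ord0 scale1r wick0r addr0].
exists ((muC - h * e%:R) *: q + J ^+ e).
  by apply: inBD; [exact: inBZ|exact: (inB_bihom (@bihom_Jn e))].
have -> : \prod_(d < e.+1) (muC - h * d%:R)
    = (muC - h * e%:R) * \prod_(d < e) (muC - h * d%:R).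
  by rewrite big_ord_recr /= mulrC.
by rewrite exprS (mulJ (@bihom_Jn e)) {1}eq scalerDr scalerA -addrA -wickZr -wickDr.
Qed.

(* Modulo the ideal, the pointwise power J^(k+2), which is in the quadratic module, is
   the product of the [muC - h d] for [d <= k + 1], whose last factor only is negative.
   Hence [- 1] is in the quadratic module. *)
Lemma qmod_off_spectrum k f : h * k%:R < muC -> muC < h * k.+1%:R ->
  inB f -> wherm f -> QM f.
Proof.
move=> lt1 lt2; apply: (qmod_neg1_all S).
have [q hq eq] := Jn_modx k.+2.
set c := \prod_(d < k.+2) (muC - h * d%:R) in eq.
have c_lt0 : c < 0.
  rewrite /c big_ord_recr /= pmulr_rlt0 ?subr_lt0 // prodr_gt0 // => d _.
  rewrite subr_gt0; apply: le_lt_trans lt1.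
  by rewrite ler_pM2l ?h_gt0 // ler_nat -ltnS.
have c0 : c != 0 by rewrite lt_eqF.
have qJ : QM (J ^+ k.+2).
  have := @qmod_mulJn k.+2 0 1; rewrite pconj1 !mulr1; apply; last exact: bihom1.
  (* Here $n \ge 1$ enters: $k + 2 - (n + 1) \le k$. *)
  rewrite add0n -[n.+1%:R - _]opprB mulrN subr_gt0.
  apply: le_lt_trans lt1; rewrite ler_pM2l ?h_gt0 //.
  by rewrite lerBlDr -natrD ler_nat addnS ltnS -addn1 leq_add2l.
apply: (qmod_modx S (q := c^-1 *: q) (qmodZ S (c := - c^-1) _ qJ)).
- by rewrite oppr_ge0 invr_le0 ltW.
- by rewrite pconjN pconj1.
- exact: inBZ.
rewrite eq scalerDr scalerA mulNr mulVf // wickZr !scaleNr scale1r.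
by rewrite -addrA addNr addr0.
Qed.

End Reduction.

(** * The case where $\mu = \hbar k$ is an eigenvalue of [J] *)

Section Spectrum.
Variables (R : realType) (n : nat) (hb mu : R).
Hypotheses (hn : (0 < n)%N) (hhb : 0 < hb).
Local Notation C := R[i].
Local Notation WP := {mpoly C[n.+1 + n.+1]}.
Local Notation FP := {mpoly C[n.+1]}.
Local Notation h := (hb%:C)%C.
Local Notation muC := (mu%:C)%C.
Local Notation z i := ('X_(zvar i) : WP).
Local Notation zb i := ('X_(zbvar i) : WP).
Local Notation dzb i := (mderiv (zbvar i)).
Local Notation "f ⋆ g" := (wick hb f g) (at level 40, left associativity).
Local Notation J := (Jpoly R n).
Local Notation x := (Jpoly R n - muC%:MP).
Local Notation QM := (@qmod C WP (wick hb) (@pconj R n) (@inB R n) x).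
Local Notation null := (@qnull C WP (wick hb) (@pconj R n) (@inB R n) x).
Implicit Types (f g : WP) (p q : FP) (K L : 'X_{1..n.+1}) (i j : 'I_n.+1) (c : C)
  (m : 'X_{1..n.+1 + n.+1}).
Local Notation S := (wick_axioms n mu hhb).

(** The negative of one summand is the negative of the sum plus the remaining summands, all in the
    quadratic module. *)
Lemma qnull_summand (I : finType) (F : I -> WP) (i0 : I) :
  (forall y, QM (F y)) -> null (\sum_y F y) -> null (F i0).
Proof.
move=> qF nF; apply: (qnull_herm S (qF i0)).
have hF : pconj (\sum_y F y) = \sum_y F y.
  by rewrite pconj_sum; apply: eq_bigr => y _; apply: (qmod_herm S (qF y)).
have -> : - F i0 = - (\sum_y F y) + \sum_(y | y != i0) F y.
  by rewrite [\sum_y F y](bigD1 i0) //= opprD addrNK.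
apply: (qmodD S); first exact: (qnull_qmodN S).
by apply: big_ind => //; [exact: (qmod0 S)|exact: (qmodD S)].
Qed.

Section OnSpectrum.
Variable k : nat.
Hypothesis mu_k : muC = h * k%:R.

(** The extreme case [d = k.+1] gives $\hbar n$, which is positive because $n \ge 1$. *)
Lemma spectrum_pos d : (d <= k.+1)%N -> 0 < muC + h * (n.+1%:R - d%:R).
Proof.
move=> le_d; rewrite mu_k -mulrDr pmulr_rgt0 ?h_gt0 // addrA -natrD subr_gt0 ltr_nat.
by rewrite (leq_ltn_trans le_d) // addnS ltnS -addn1 leq_add2l.
Qed.

Lemma bihom_zmon K : bihom (mdeg K) 0 ('X_[zmon K] : WP).
Proof.
move=> m; rewrite msuppX inE => /eqP ->; rewrite mdeg_holo mdeg_anti mdegE.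
split; first by apply: eq_bigr => i _; rewrite zmon_zvar.
by apply: big1 => i _; rewrite zmon_zbvar.
Qed.

(* The case [K = 0] holds because the factor [d = k] of [Jn_modx] vanishes. The general
   case follows since J^(e+1) p p^* is the sum of the J^e (z_i p)(z_i p)^*, all of which
   lie in the quadratic module. *)
Lemma qnull_zmon e K : (mdeg K + e)%N = k.+1 ->
  null (J ^+ e * ('X_[zmon K] * pconj 'X_[zmon K])).
Proof.
elim/multinom_ind: K e => [|i K IH] e.
  rewrite mdeg0 add0n => ->.
  have -> : zmon (0%MM : 'X_{1..n.+1}) = 0%MM.
    by apply/eqP; rewrite -mdeg_eq0 mdeg_zmon mdeg0.
  rewrite mpolyX0 pconj1 !mulr1; have [q hq ->] := Jn_modx n hb mu k.+1.
  have -> : \prod_(d < k.+1) (muC - h * d%:R) = 0.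
    by rewrite big_ord_recr /= mu_k subrr mulr0.
  by rewrite scale0r add0r; apply: (qnull_ideal S).
rewrite mdegD mdeg1 addn1 addSnnS => hK.
have nK := IH e.+1 hK.
pose F l : WP := J ^+ e * ((z l * 'X_[zmon K]) * pconj (z l * 'X_[zmon K])).
have eF : J ^+ e.+1 * ('X_[zmon K] * pconj 'X_[zmon K]) = \sum_l F l.
  by rewrite exprSr -mulrA mulJ_pconj mulr_sumr.
have -> : zmon (K + U_(i)) = (U_(zvar i) + zmon K)%MM by rewrite zmonD1 addmC.
rewrite mpolyXD -/(F i); apply: qnull_summand; last by rewrite -eF.
move=> l; apply: (@qmod_mulJn R n hb mu hhb e (mdeg K).+1).
  by apply: spectrum_pos; rewrite addSnnS hK.
exact/bihom_z/bihom_zmon.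
Qed.

Lemma pconj_zmon K : pconj ('X_[zmon K] : WP) = 'X_[zbmon K].
Proof.
rewrite pconjX; congr mpolyX; apply/mnmP; elim/var_ind => i.
  by rewrite swapmE swapvar_zvar !varE.
by rewrite swapmE swapvar_zbvar !varE.
Qed.

(** Polarization of [qnull_zmon]: for $|c| = 1$ the elements [F c] and [F (- c)] lie in the
    quadratic module and have a null sum, so each is null, and with it the cross term [G c]. *)
Lemma qnull_zmon_zbmon K L : mdeg K = k.+1 -> mdeg L = k.+1 ->
  null ('X_[zmon K] * 'X_[zbmon L]).
Proof.
move=> hK hL; rewrite -pconj_zmon.
set p : WP := 'X_[zmon K]; set q : WP := 'X_[zmon L].
have hp : bihom k.+1 0 p by rewrite -hK; apply: bihom_zmon.
have hq : bihom k.+1 0 q by rewrite -hL; apply: bihom_zmon.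
have np : null (p * pconj p).
  by have := @qnull_zmon 0 K; rewrite expr0 mul1r addn0; apply.
have nq : null (q * pconj q).
  by have := @qnull_zmon 0 L; rewrite expr0 mul1r addn0; apply.
pose F c := (p + c *: q) * pconj (p + c *: q).
pose G c := c^* *: (p * pconj q) + c *: (q * pconj p).
have FE c : F c = p * pconj p + (c * c^*) *: (q * pconj q) + G c.
  rewrite /F /G pconjD pconjZ -!mul_mpolyC mpolyCM.
  move: (pconj p) (pconj q) (c%:MP) (c^*%:MP) => p' q' u v.
  by ring.
have qF c : QM (F c).
  by apply: (qmod_mul_pconj hhb (spectrum_pos (leqnn _))); apply/bihomD/bihomZ.
have nG c : c * c^* = 1 -> null (G c).
  move=> c1; have GN : G (- c) = - G c by rewrite /G rmorphN !scaleNr opprD.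
  have nF : null (F c + F (- c)).
    rewrite !FE GN rmorphN mulrNN c1 scale1r addrACA subrr addr0.
    exact: (qnullD S (qnullD S np nq) (qnullD S np nq)).
  have -> : G c = F c - (p * pconj p + q * pconj q).
    by rewrite FE c1 scale1r addrAC subrr add0r.
  apply: (qnullB S); last exact: (qnullD S np nq).
  (* The two-term sum [F c + F (- c)] is read as a sum over [bool]. *)
  have := @qnull_summand bool (fun b => F (if b then c else - c)) true.
  by rewrite big_bool; apply.
have -> : p * pconj q = 2^-1 *: (G 1 + 'i *: G 'i).
  have -> : G 1 + 'i *: G 'i = 2 *: (p * pconj q).
    exact: polarize_pair.
  by rewrite scalerA mulVf ?pnatr_eq0 // scale1r.
apply/(qnullZ S)/(qnullD S); first by apply: nG; rewrite conjC1 mulr1.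
by apply/(qnullZ S)/nG; rewrite conjCi mulrN -expr2 sqrCi opprK.
Qed.

Lemma multinom_succ d K : mdeg K = d.+1 ->
  exists i K', mdeg K' = d /\ K = (K' + U_(i))%MM.
Proof.
move=> hK; case: (pickP (fun i => K i != 0%N)) => [i hi|h0]; last first.
  by move: hK; rewrite mdegE big1 // => i _; have := h0 i; move/negbFE/eqP.
have le : (U_(i) <= K)%MM by rewrite lep1mP.
exists i, (K - U_(i))%MM; rewrite submK //; split=> //.
by move: hK; rewrite -{1}(submK le) mdegD mdeg1 addn1 => -[].
Qed.

Lemma wick_z_zb i j f : f ⋆ (z i * zb j) = zb j * (z i * f + h *: dzb i f).
Proof. by rewrite mulrC wick_zbr -[X in f ⋆ X]mulr1 wick_zr wick1r. Qed.

Lemma mderiv_zmon i K : dzb i ('X_[zmon K] : WP) = 0.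
Proof. by rewrite mderivX zmon_zbvar scale0r. Qed.

(** Induction on the degree: the monomial is a null monomial of degree one less, multiplied on the
    right by [z i * zb j], minus a correction. The correction again has the lower degree, so the
    induction hypothesis covers it. *)
Lemma qnull_zmon_zbmon_high d K L : (k < d)%N -> mdeg K = d -> mdeg L = d ->
  null ('X_[zmon K] * 'X_[zbmon L]).
Proof.
elim: d K L => // d IH K L; rewrite ltnS leq_eqVlt => /predU1P[<-|lt_kd].
  exact: qnull_zmon_zbmon.
move=> /multinom_succ[i [K' [hK ->]]] /multinom_succ[j [L' [hL ->]]].
pose f : WP := 'X_[zmon K'] * 'X_[zbmon L'].
have nf : null f by apply: IH.
have hB : inB (z i * zb j).
  by rewrite -[zb j]mulr1; apply: (@inB_bihom _ _ 1); apply/bihom_z/bihom_zb/bihom1.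
have e : 'X_[zmon (K' + U_(i))] * 'X_[zbmon (L' + U_(j))]
    = f ⋆ (z i * zb j)
      - (h * (L' i)%:R) *: ('X_[zmon K'] * 'X_[zbmon (L' - U_(i) + U_(j))]).
  rewrite wick_z_zb mderivM mderiv_zmon mul0r add0r mderivX zbmon_zbvar.
  rewrite !zmonD1 !zbmonD1 !mpolyXD /f.
  (* The truncated subtraction behaves as expected only for [L' i != 0]; in the other case the
     coefficient [L' i] removes the term. *)
  have -> : 'X_[zbmon L' - U_(zbvar i)] = (L' i == 0%N)%:R *: 'X_[zbmon L' - U_(zbvar i)]
    + (L' i != 0%N)%:R *: 'X_[zbmon (L' - U_(i))] :> WP.
    case: (posnP (L' i)) => [_|hi] /=; first by rewrite scale0r scale1r addr0.
    rewrite scale0r add0r scale1r.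
    have le : (U_(i) <= L')%MM by rewrite lep1mP -lt0n.
    by rewrite -{1}(submK le) zbmonD1 addmK.
  rewrite -!mul_mpolyC !mpolyCM.
  case: (posnP (L' i)) => [->|hi] /=; rewrite ?mpolyC0 ?mpolyC1; by ring.
rewrite e; apply: (qnullB S); first exact: (qnull_starr S nf hB).
case: (posnP (L' i)) => [->|hi].
  by rewrite mulr0 scale0r; apply: (qnull0 S).
apply/(qnullZ S)/IH => //.
have le : (U_(i) <= L')%MM by rewrite lep1mP -lt0n.
by rewrite mdegD mdeg1 -(mdeg1 i) -mdegD submK.
Qed.

Lemma qnull_high d f : (k < d)%N -> bihom d d f -> null f.
Proof.
move=> lt_kd hf; rewrite [f]mpolyE; apply: (qnull_sum S) => m /hf[h1 h2].
apply: (qnullZ S); rewrite (holo_antiK m) mpolyXD.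
exact: (qnull_zmon_zbmon_high lt_kd).
Qed.

Lemma approx_bihom d f : bihom d d f ->
  exists2 r, bihom k k r & null (f - r).
Proof.
case: (ltnP k d) => [lt_kd|le_dk] hf.
  by exists 0; [exact: bihom0|rewrite subr0; apply: (qnull_high lt_kd)].
move: {2}(k - d)%N (erefl (k - d)%N) => e.
elim: e d f le_dk hf => [|e IH] d f le_dk hf ed.
  have E : d = k by apply/eqP; rewrite eqn_leq le_dk -subn_eq0 ed.
  by exists f; [rewrite -{1 2}E|rewrite subrr; apply: (qnull0 S)].
have lt_dk : (d < k)%N by rewrite -subn_gt0 ed.
have [r hr nr] := IH d.+1 (J * f) lt_dk (bihomJ hf) (etrans (subnS _ _) (congr1 predn ed)).
(* Below degree [k] the factor $s = \hbar(k-d)$ is nonzero, so [mulJ] can be solved for [f] modulo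
   the ideal. *)
set s := muC - h * d%:R.
have s0 : s != 0.
  rewrite /s mu_k -mulrBr mulf_neq0 ?gt_eqF ?h_gt0 // -natrB ?(ltnW lt_dk) //.
  by rewrite ltr0n subn_gt0.
exists (s^-1 *: r); first exact: bihomZ.
have -> : f - s^-1 *: r = s^-1 *: (J * f - r) - s^-1 *: (x ⋆ f).
  rewrite (mulJ hb mu hf) -/s -!scalerBr addrAC addrK scalerBr scalerA mulVf //.
  by rewrite scale1r.
apply: (qnullB S); first exact: (qnullZ S _ nr).
exact/(qnullZ S)/(qnull_ideal S)/inB_bihom/hf.
Qed.

Lemma approx f : inB f -> exists2 r, bihom k k r & null (f - r).
Proof.
move=> hf; pose P f := exists2 r, bihom k k r & null (f - r).
rewrite [f]mpolyE big_seq; apply: (big_ind P).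
- by exists 0; [exact: bihom0|rewrite subr0; apply: (qnull0 S)].
- move=> u v [r hr nr] [r' hr' nr']; exists (r + r'); first exact: bihomD.
  by rewrite opprD addrACA; exact: (qnullD S nr nr').
move=> m /hf hm; have := bihomZ (c := f@_m) (@bihomX R n m).
by rewrite -hm => hX; exact: (approx_bihom hX).
Qed.

Lemma approx_herm f : inB f -> wherm f ->
  exists r, [/\ bihom k k r, wherm r & null (f - r)].
Proof.
move=> hf st_f; have [r hr nr] := approx hf.
exists (2^-1 *: (r + pconj r)); split.
- by apply/bihomZ/bihomD => //; apply: bihom_pconj.
- by rewrite /wherm pconjZ pconjD pconjK conjC_half addrC.
have -> : f - 2^-1 *: (r + pconj r) = 2^-1 *: ((f - r) + pconj (f - r)).
  rewrite pconjB st_f addrACA -opprD scalerBr -mulr2n -[f *+ 2]scaler_nat scalerA.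
  by rewrite mulVf ?pnatr_eq0 // scale1r.
exact: (qnullZ S 2^-1 (qnullD S nr (qnull_st S nr))).
Qed.

(** * The coefficient matrix in bidegree $(k,k)$ and vector states *)

Definition hmon := {K : 'X_{1..n.+1 < k.+1} | mdeg K == k}.
Definition hval (s : hmon) : 'X_{1..n.+1} := val (val s).

Lemma mdeg_hval s : mdeg (hval s) = k.
Proof. exact/eqP/(valP s). Qed.

Lemma hval_inj : injective hval.
Proof. by move=> s t /val_inj/val_inj. Qed.

Lemma hvalP K : mdeg K = k -> exists s, hval s = K.
Proof.
move=> hK; have lt : (mdeg K < k.+1)%N by rewrite hK.
have eqk : mdeg (BMultinom lt) == k by apply/eqP.
by exists (exist _ (BMultinom lt) eqk).
Qed.

Lemma zmon_zbmon_inj K L K' L' :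
  (zmon K + zbmon L)%MM = (zmon K' + zbmon L')%MM -> K = K' /\ L = L'.
Proof.
move/mnmP => e; split; apply/mnmP => i.
  by have := e (zvar i); rewrite !varE !addn0.
by have := e (zbvar i); rewrite !varE.
Qed.

Lemma bihom_expand (r : WP) : bihom k k r ->
  r = \sum_s \sum_t r@_(zmon (hval s) + zbmon (hval t)) *:
    ('X_[zmon (hval s)] * pconj 'X_[zmon (hval t)]).
Proof.
move=> hr; apply/mpolyP => m; rewrite raddf_sum /=.
under eq_bigr => s _.
  rewrite raddf_sum /=.
  under eq_bigr => t _ do rewrite mcoeffZ pconj_zmon -mpolyXD mcoeffX.
  over.
have [hm|hm] := boolP (m \in msupp r); last first.
  rewrite (memN_msupp_eq0 hm) big1 // => s _; rewrite big1 // => t _.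
  by case: eqP => [->|_]; rewrite ?mulr0 // (memN_msupp_eq0 hm) mul0r.
have [h1 h2] := hr _ hm.
have [s es] := hvalP h1; have [t et] := hvalP h2.
have em : m = (zmon (hval s) + zbmon (hval t))%MM by rewrite es et -holo_antiK.
rewrite (bigD1 s) //= (bigD1 t) //= -em eqxx mulr1.
rewrite [X in _ + X + _]big1 ?addr0 => [|t' ne]; last first.
  case: eqP => [e|_]; last by rewrite mulr0.
  move: ne; rewrite em in e; have [_ /hval_inj ->] := zmon_zbmon_inj e.
  by rewrite eqxx.
rewrite big1 ?addr0 // => s' ne; rewrite big1 // => t' _.
case: eqP => [e|_]; last by rewrite mulr0.
move: ne; rewrite em in e; have [/hval_inj -> _] := zmon_zbmon_inj e.
by rewrite eqxx.
Qed.

Lemma mderivm_fock_homog p K : fock_homog k p -> mdeg K = k ->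
  p^`M[K] = (p@_K * (mfact K)%:R)%:MP.
Proof.
move=> hp hK; apply/mpolyP => K'; rewrite mcoeff_mderivm mcoeffC.
have [->|ne] := eqVneq K' 0%MM.
  rewrite addm0 mulr1 -[LHS]mulr_natr; congr (_ * _%:R).
  by apply: eq_bigr => i _; rewrite ffactnn.
rewrite mulr0 memN_msupp_eq0 ?mul0rn //; apply/negP => /hp.
by rewrite mdegD hK -[RHS]addn0 => /addnI/eqP; rewrite mdeg_eq0 (negbTE ne).
Qed.

(** The factorials are divided out so that applying $\partial^K$ returns exactly [v] at $K$; the
    expectation values then become the plain quadratic form of the coefficient matrix, up to a power
    of [h]. *)
Definition fock_of (v : hmon -> C) : FP :=
  \sum_s (v s / (mfact (hval s))%:R) *: 'X_[hval s].

Lemma fock_of_homog v : fock_homog k (fock_of v).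
Proof.
move=> K; rewrite mcoeff_msupp raddf_sum /= => /eqP nz.
apply/eqP/negPn/negP => hK; apply: nz; apply: big1 => s _.
rewrite mcoeffZ mcoeffX; case: eqP => [e|_]; last by rewrite mulr0.
by move: hK; rewrite -e mdeg_hval eqxx.
Qed.

Lemma mcoeff_fock_of v s : (fock_of v)@_(hval s) = v s / (mfact (hval s))%:R.
Proof.
rewrite raddf_sum /= (bigD1 s) //= mcoeffZ mcoeffX eqxx mulr1 big1 ?addr0 //.
move=> t ne; rewrite mcoeffZ mcoeffX (inj_eq hval_inj) (negbTE ne).
by rewrite mulr0.
Qed.

Lemma piF_fock_of K v t : mdeg K = k ->
  piF hb ('X_[zmon K] * pconj 'X_[zmon (hval t)]) (fock_of v)
  = (h ^+ k * v t) *: 'X_[K].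
Proof.
move=> hK; rewrite pconj_zmon -mpolyXD piFX /piF_mon.
have -> : holo (zmon K + zbmon (hval t)) = K.
  by apply/mnmP => i; rewrite mnmE !varE addn0.
have -> : anti (zmon K + zbmon (hval t)) = hval t.
  by apply/mnmP => i; rewrite mnmE !varE.
rewrite mdeg_hval (mderivm_fock_homog (@fock_of_homog v)) ?mdeg_hval //.
rewrite mcoeff_fock_of divfK ?mfact_neq0 // mulrC mul_mpolyC scalerA.
by [].
Qed.

Lemma fock_inner_fock_of (r : WP) v : bihom k k r ->
  fock_inner hb (fock_of v) (piF hb r (fock_of v))
  = h ^+ (k + k) * \sum_s \sum_t (v s)^* * v t * r@_(zmon (hval s) + zbmon (hval t)).
Proof.
move=> hr; rewrite {1}(bihom_expand hr) piF_suml linear_sum /= mulr_sumr.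
apply: eq_bigr => s _; rewrite piF_suml linear_sum /= mulr_sumr.
apply: eq_bigr => t _; rewrite piFZl piF_fock_of ?mdeg_hval // !fock_innerZr.
rewrite -(fock_inner_conj hhb) (fock_innerX hb) rmorphM /=.
rewrite (CrealP (gtr0_real (fock_weight_gt0 hhb _))) mcoeff_fock_of.
rewrite rmorphM fmorphV /= conjC_nat /fock_weight mdeg_hval exprD.
have w0 := mfact_neq0 R (hval s).
move: (mfact _)%:R (h ^+ k) w0 => w H w0.
by rewrite [H * w]mulrC -!mulrA mulKf //; ring.
Qed.

(** A vector of degree [k] is an eigenvector of [J] with eigenvalue $\hbar k = \mu$, hence is
    annihilated by [x]. *)
Lemma vec_state_null p : fock_homog k p -> vec_state hb p (x ⋆ x) = 0.
Proof.
move=> hp; rewrite /vec_state piF_wick.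
have -> : piF hb x p = 0.
  rewrite -scaleN1r piFDl piFZl (piF_J hb hp) mpolyC_scale piFZl piF1 mu_k.
  by rewrite scaleN1r subrr.
by rewrite !linear0 mul0r.
Qed.

(** The vector states of degree [k] are admissible in [Rred] and force the coefficient matrix of [r]
    to be positive semidefinite. Its rank-one summands are the products [P l * pconj (P l)]. *)
Lemma qmod_bihom (r : WP) : bihom k k r -> Rred hb mu r -> QM r.
Proof.
move=> hr [hB st_r pos].
pose c (s t : hmon) := r@_(zmon (hval s) + zbmon (hval t)).
have herm s t : (c s t)^* = c t s.
  rewrite /c -[r in RHS]st_r mcoeff_pconj; congr (_@__)^*.
  by apply/mnmP; elim/var_ind => i;
     rewrite swapmE ?swapvar_zvar ?swapvar_zbvar !varE ?addn0.
have [v|w hw] := psd_decomposition herm.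
  (* The zero vector gives no state, but there the quadratic form vanishes as well. *)
  have [/eqP v0|v0] := boolP (fock_of v == 0).
    have := fock_inner_fock_of v hr; rewrite {1}v0.
    rewrite -(fock_inner_conj hhb) linear0 conjC0 => /esym/eqP.
    rewrite mulf_eq0 expf_eq0 (gt_eqF (h_gt0 hhb)) andbF => /eqP ->.
    exact: lexx.
  have := pos _ (vec_stateP hhb v0) (vec_state_null (@fock_of_homog v)).
  rewrite /vec_state (fock_inner_fock_of v hr) pmulr_lge0; last first.
    rewrite invr_gt0 lt0r (fock_inner_ge0 hhb) andbT.
    by apply: contraNneq v0 => /(fock_inner_eq0 hhb) ->.
  by rewrite pmulr_rge0 // exprn_gt0 // h_gt0.
pose P l : WP := \sum_s w l s *: 'X_[zmon (hval s)].
have -> : r = \sum_l P l * pconj (P l).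
  rewrite (bihom_expand hr).
  under eq_bigr => s _.
    under eq_bigr => t _ do rewrite -/(c s t) hw scaler_suml.
    rewrite exchange_big /=; over.
  rewrite exchange_big /=; apply: eq_bigr => l _.
  rewrite /P pconj_sum mulr_suml; apply: eq_bigr => s _.
  rewrite mulr_sumr; apply: eq_bigr => t _.
  by rewrite pconjZ -scalerAl -scalerAr scalerA.
apply: big_ind => [||l _]; [exact: (qmod0 S)|exact: (qmodD S)|].
apply: (qmod_mul_pconj hhb (spectrum_pos (leqnSn k))).
apply: bihom_sum => s _; apply: bihomZ.
by rewrite -{1}(mdeg_hval s); apply: bihom_zmon.
Qed.

(** [r] is the sum of [f] and [- (f - r)], and the latter lies in the quadratic module, where the
    states in question are nonnegative. *)
Lemma Rred_mod_qnull f (r : WP) : Rred hb mu f -> inB r -> wherm r -> null (f - r) ->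
  Rred hb mu r.
Proof.
move=> [hf st_f pos] hr st_r nfr; split=> // omega hom hx.
have -> : r = f + - (f - r) by rewrite opprB addrC subrK.
have st_fr : pconj (f - r) = f - r by rewrite pconjB st_f st_r.
have qN := qnull_qmodN S st_fr nfr.
rewrite (stateD hom hf (qmod_subB S qN)).
apply: addr_ge0; first exact: pos.
exact: (qmod_state_ge0 hhb hom hx qN).
Qed.

Lemma qmod_on_spectrum f : Rred hb mu f -> QM f.
Proof.
move=> rf; have [hf st_f _] := rf.
have [r [hr st_r nfr]] := approx_herm hf st_f.
have -> : f = r + (f - r) by rewrite addrC subrK.
apply: (qmodD S).
  exact/(qmod_bihom hr)/(Rred_mod_qnull rf (inB_bihom hr) st_r nfr).
by apply: (qnull_qmod S) nfr; rewrite pconjB st_f st_r.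
Qed.

End OnSpectrum.

End Spectrum.

(** * Passage to the generated ideal and case distinction on $\mu$ *)

Lemma qmod_Rred (R : realType) (n : nat) (hb mu : R) (f : WPoly R n) : 0 < hb ->
  @qmod _ {mpoly R[i][n.+1 + n.+1]} (wick hb) (@pconj R n) (@inB R n)
    (Jpoly R n - (mu%:C)%C%:MP) f -> Rred hb mu f.
Proof.
move=> hhb qf; have S := wick_axioms n mu hhb.
split; [exact: (qmod_subB S qf)|exact: (qmod_herm S qf)|].
by move=> omega hom hx; exact: (qmod_state_ge0 hhb hom hx qf).
Qed.

(** As [x] commutes with [B], it can be pulled to the front of every term; as it is Hermitian, the
    two families of generators merge. *)
Lemma in_star_idealP (R : realType) (n : nat) (hb mu : R) (f : WPoly R n) : 0 < hb ->
  in_star_ideal hb (Jpoly R n - (mu%:C)%C%:MP) f <->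
  exists2 q, inB q & f = wick hb (Jpoly R n - (mu%:C)%C%:MP) q.
Proof.
move=> hhb; have S := wick_axioms n mu hhb; split.
  move=> [s [t [hs [ht ->]]]].
  exists (\sum_(p <- s) wick hb p.1 p.2 + \sum_(p <- t) wick hb p.1 p.2).
    by apply: inBD; apply: inB_sum => p; [move/hs|move/ht] => -[h1 h2]; apply: inB_wick.
  rewrite wickDr !wick_sumr pconjx.
  by apply: f_equal2; rewrite big_seq [RHS]big_seq; apply: eq_bigr => p;
     [move/hs|move/ht] => -[h1 _]; rewrite !wickA (sa_xC S h1).
move=> [q hq ->]; exists [:: (1, q)], [::]; split.
  by move=> p; rewrite inE => /eqP ->; split=> //; apply: inB1.
by split=> //; rewrite big_seq1 big_nil addr0 wick1l.
Qed.

Lemma Rred_qmod (R : realType) (n : nat) (hn : (0 < n)%N) (hb mu : R) (f : WPoly R n) :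
  0 < hb -> 0 <= mu -> Rred hb mu f ->
  @qmod _ {mpoly R[i][n.+1 + n.+1]} (wick hb) (@pconj R n) (@inB R n)
    (Jpoly R n - (mu%:C)%C%:MP) f.
Proof.
move=> hhb hmu rf; have [hf st_f _] := rf.
(* With $k$ the integer part of $\mu/\hbar$, either $\mu = \hbar k$ or $\mu$ lies strictly between
   $\hbar k$ and $\hbar(k+1)$. *)
have /andP[le lt] : (Num.truncn (mu / hb))%:R <= mu / hb < (Num.truncn (mu / hb)).+1%:R.
  by apply: truncn_itv; rewrite divr_ge0 // ltW.
move: (Num.truncn _) le lt => k; rewrite ler_pdivlMr // ltr_pdivrMr // => le lt.
have castE j : (hb%:C)%C * j%:R = ((j%:R * hb)%:C)%C :> R[i].
  by rewrite rmorphM rmorph_nat mulrC.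
move: le; rewrite le_eqVlt => /predU1P[e|lt'].
  by apply: (qmod_on_spectrum hn hhb (k := k)) rf; rewrite castE e.
by apply: (qmod_off_spectrum hn hhb (k := k)) => //; rewrite castE ltcR.
Qed.

Theorem theorem4p7 (R : realType) (n : nat) (hn : (0 < n)%N)
  (hb : R) (hhb : 0 < hb) (mu : R) (hmu : 0 <= mu) (f : WPoly R n) :
  Rred hb mu f <->
  exists g h : WPoly R n,
    [/\ sosB hb g,
        in_star_ideal hb (Jpoly R n - ((mu%:C)%C%:MP)) h,
        wherm h &
        f = g + h].
Proof.
split.
  move=> /(Rred_qmod hn hhb hmu)[s [q [hs hq st_q ->]]].
  exists (\sum_(a <- s) wick hb (pconj a) a), (wick hb (Jpoly R n - (mu%:C)%C%:MP) q).
  split=> //; first by exists s.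
  by apply/(in_star_idealP _ _ hhb); exists q.
move=> [g [h [[s [hs ->]] /(in_star_idealP _ _ hhb)[q hq ->] st_q ->]]].
by apply: qmod_Rred => //; exists s, q.
Qed.
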